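(* Assume (A1)–(A2) and $N\geq 1$ (with $\max\{1,\|f\|_\infty/2\}\le N\le h/(2\tau)$ as in the setting of the scheme). Let $V_n:=V^{\tau,h}_n$ ($n\ge0$) and $V:=V^{\tau,h}$ be, respectively, solutions to the discrete space-time policy iteration equations and the discrete space-time HJB equation described in the context. Then there exists a universal constant $C>0$ such that if $C(1+\|\nabla^h V\|^2_\infty)\tau\leq h$, then for all $n\geq 1$, $R\geq 1$ and $t\in \mathbb{N}_T^\tau$, \[ \sum_{x\in h\mathbb{Z}^d, |x|\leq R}\left|V_n(t,x)-V(t,x)\right|^2 \leq \frac{h\tau}{2^{n+1}} \sum_{s\in \mathbb{N}_{T}^\tau,\, s\ge t}\ \sum_{ x\in h\mathbb{Z}^d} \exp\left[C\exp(1+\|\nabla^h V\|^2_\infty)(s-t)/h\right] \left|D^h(V_0(s,x)-V(s,x))\right|^2\min\left\{1,e^{-|x|+R+1}\right\}. \] In particular, \[ \max_{t\in\mathbb{N}_T^\tau}\sum_{x\in h\mathbb{Z}^d, |x|\leq R}\left|V_n(t,x)-V(t,x)\right|^2 \leq C2^{-n}\exp\left[C\exp(CT)/h\right]R^d, \] \[ \max_{t\in\mathbb{N}_T^\tau}\sum_{ x\in h\mathbb{Z}^d,|x|\leq R}\left|\alpha(t,x,\nabla^h V_n(t,x))- \alpha(t,x,\nabla^h V(t,x))\right|^2\leq C2^{-n}\exp\left[C\exp(CT)/h\right]R^d. \]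
   Context: Let $d,m\ge1$, $T\ge 1$, $A\subset\mathbb{R}^m$ compact, $c:[0,T]\times\mathbb{R}^d\times A\to\mathbb{R}$, $f:[0,T]\times\mathbb{R}^d\times A\to\mathbb{R}^d$, $q:\mathbb{R}^d\to\mathbb{R}$. Let $\alpha(t,x,p)=\operatorname{argmin}_{a\in A}[c(t,x,a)+p\cdot f(t,x,a)]$, assumed to be the unique minimizer, and $H(t,x,p)=\min_{a\in A}[c(t,x,a)+p\cdot f(t,x,a)]$. Assumptions: (A1) $c,f,q$ are uniformly bounded and Lipschitz continuous in all their variables; (A2) $\alpha(\cdot,\cdot,\cdot)$ and a given initial policy $\alpha_0(t,x)$ are uniformly Lipschitz continuous in all their variables. Let $\tau,h\in(0,1)$ with $T/\tau$ a positive integer and $N$ with $\max\{1,\|f\|_\infty/2\}\le N\le h/(2\tau)$. Set $\mathbb{N}_T^\tau=\{0,\tau,2\tau,\dots,T\}$, $\Omega_T^{\tau,h}=\mathbb{N}_T^\tau\times h\mathbb{Z}^d$, $\Omega_T'=(\mathbb{N}_T^\tau\setminus\{0\})\times h\mathbb{Z}^d$. For a function $\varphi$ on $h\mathbb{Z}^d$: $\nabla^h\varphi(x)=\big(\frac{\varphi(x+he_i)-\varphi(x-he_i)}{2h}\big)_{i=1}^d$, $\Delta^h\varphi(x)=\sum_{i=1}^d\frac{\varphi(x+he_i)-2\varphi(x)+\varphi(x-he_i)}{h^2}$, $D^h\varphi(x)=\big(\frac{\varphi(x+he_i)-\varphi(x)}{h}\big)_{i=1}^d$ (acting in $x$), and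 $\partial_t^\tau V(t,x)=\frac{V(t,x)-V(t-\tau,x)}{\tau}$. Discrete policy iteration: for $n=0,1,\dots$, $V_n^{\tau,h}:\Omega_T^{\tau,h}\to\mathbb{R}$ solves $\partial_t^\tau V_n^{\tau,h}(t,x)+c(t,x,\alpha_n(t,x))+\nabla^h V_n^{\tau,h}(t,x)\cdot f(t,x,\alpha_n(t,x))=-Nh\Delta^h V_n^{\tau,h}(t,x)$ for $(t,x)\in\Omega_T'$, $V_n^{\tau,h}(T,x)=q(x)$ on $h\mathbb{Z}^d$, and $\alpha_{n+1}(t,x)=\alpha(t,x,\nabla^h V_n^{\tau,h}(t,x))$ on $\Omega_T'$. $V^{\tau,h}:\Omega_T^{\tau,h}\to\mathbb{R}$ solves $\partial_t^\tau V^{\tau,h}+H(t,x,\nabla^h V^{\tau,h})=-Nh\Delta^h V^{\tau,h}$ on $\Omega_T'$, $V^{\tau,h}(T,x)=q(x)$ on $h\mathbb{Z}^d$. A constant is universal if it depends only on $d$, $N$ and the constants in (A1)–(A2). *)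

(* Defs.v *)
From HB Require Import structures.
From mathcomp Require Import all_boot all_order all_algebra.
From mathcomp Require Import all_classical all_reals all_analysis.
Set Implicit Arguments. Unset Strict Implicit. Unset Printing Implicit Defensive.
Import Order.TTheory GRing.Theory Num.Theory.
Local Open Scope ring_scope.
Local Open Scope classical_set_scope.

Section Defs.
Variable R : realType.

Definition enorm (n : nat) (v : 'rV[R]_n) : R := Num.sqrt (\sum_(i < n) v 0 i ^+ 2).
Definition dotp (n : nat) (u v : 'rV[R]_n) : R := \sum_(i < n) u 0 i * v 0 i.

(* lattice h Z^d : the point x = h k is encoded by k : 'rV[int]_d *)
Definition ev (d : nat) (i : 'I_d) : 'rV[int]_d := delta_mx 0 i.
Definition pt (d : nat) (h : R) (k : 'rV[int]_d) : 'rV[R]_d :=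
  \row_(i < d) (h * (k 0 i)%:~R).

Definition gradh (d : nat) (h : R) (u : 'rV[int]_d -> R) (k : 'rV[int]_d) : 'rV[R]_d :=
  \row_(i < d) ((u (k + ev i) - u (k - ev i)) / (2 * h)).
Definition laplh (d : nat) (h : R) (u : 'rV[int]_d -> R) (k : 'rV[int]_d) : R :=
  \sum_(i < d) ((u (k + ev i) - 2 * u k + u (k - ev i)) / h ^+ 2).
Definition Dh (d : nat) (h : R) (u : 'rV[int]_d -> R) (k : 'rV[int]_d) : 'rV[R]_d :=
  \row_(i < d) ((u (k + ev i) - u k) / h).

(* time grid: t_j = j * tau, j = 0..M, T = M * tau *)
Definition tg (tau : R) (j : nat) : R := j%:R * tau.

Definition Ham (d m : nat) (A : set 'rV[R]_m)
  (c : R -> 'rV[R]_d -> 'rV[R]_m -> R) (f : R -> 'rV[R]_d -> 'rV[R]_m -> 'rV[R]_d)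
  (t : R) (x p : 'rV[R]_d) : R :=
  inf [set (c t x a + dotp p (f t x a)) | a in A].

Definition policy (d m : nat) (tau h : R)
  (alpha : R -> 'rV[R]_d -> 'rV[R]_d -> 'rV[R]_m)
  (alpha0 : R -> 'rV[R]_d -> 'rV[R]_m)
  (Vn : nat -> nat -> 'rV[int]_d -> R) (n j : nat) (k : 'rV[int]_d) : 'rV[R]_m :=
  if n is n'.+1 then alpha (tg tau j) (pt h k) (gradh h (Vn n' j) k)
  else alpha0 (tg tau j) (pt h k).

Definition gradsup (d : nat) (M : nat) (h : R) (V : nat -> 'rV[int]_d -> R) : R :=
  sup [set r | exists j k, (j <= M)%N /\ r = enorm (gradh h (V j) k)].

End Defs.

(* Main.v *)
(** The error [W = V_n - V] solves the linear scheme driven by the policy [alpha_n],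
    with a source controlled by the gradient of the previous error. Testing with the
    weight [min (1, e^(r+1-|x|))], whose neighbouring values differ by a factor at most 3,
    the discrete viscosity yields a gradient term, while the source costs only half of the
    previous one: [E_(j-1)^n + (h tau/2) D_j^n <= rho E_j^n + (1/2) (h tau/2) D_j^(n-1)]. Summing
    over time with the weights [rho^(s-j-1)] makes the error halve at each iteration.
    The scheme is monotone, which bounds [V] and [V_n], and [V] is Lipschitz with
    constant [O(e^(CT))], which bounds the exponent; the powers of [1/h] coming from the number
    of lattice points are absorbed by the exponential. *)
Require Import Defs.
From HB Require Import structures.
From mathcomp Require Import all_boot all_order all_algebra.
From mathcomp Require Import all_classical all_reals all_analysis.
From mathcomp Require Import ring lra.
Set Implicit Arguments. Unset Strict Implicit. Unset Printing Implicit Defensive.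
Import Order.TTheory GRing.Theory Num.Theory.
Import numFieldNormedType.Exports.
Local Open Scope ring_scope.
Local Open Scope classical_set_scope.

(** * Energy inequality at a single lattice point *)

Section FiniteSums.
Context {R : realType}.
Implicit Types (d : nat).

(** The error is bounded but not known to be summable, so lattice sums take values in [\bar R],
    where nothing can be subtracted. Every estimate therefore keeps nonnegative terms on both sides,
    and summation by parts is avoided: the viscosity is used pointwise through
    [2 * u * p = (u + p)^2 - u^2 - p^2], and the squares at the neighbours are brought back by
    translating the sum, the weight paying a factor 3. This leftover, like the transport and source
    terms, enters the growth per step multiplied by [tau / h]; hence the [1 / h] in the exponent.

    The constants [1/16] and [64] leave room for the loss in the source term: its one-sided
    differences go both ways, and the backward ones cost three times the forward ones, so [1/16]
    becomes [1/4], exactly half of the [1/2] on the left.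

    The source is split so that only the gradient of [V] multiplies the difference of the drifts. A
    Lipschitz bound is thus needed for [V] alone; for [V_n] a sup bound is enough. *)

Lemma cauchy_schwarz_sum d (a b : 'I_d -> R) :
  (\sum_i a i * b i) ^+ 2 <= (\sum_i a i ^+ 2) * (\sum_i b i ^+ 2).
Proof.
rewrite -subr_ge0 -(pmulr_rge0 _ (ltr0Sn R 1)).
(* Lagrange's identity. *)
suff -> : 2%:R * ((\sum_i a i ^+ 2) * (\sum_i b i ^+ 2) - (\sum_i a i * b i) ^+ 2)
  = \sum_i \sum_j (a i * b j - a j * b i) ^+ 2.
  by apply: sumr_ge0 => i _; apply: sumr_ge0 => j _; exact: sqr_ge0.
have -> : \sum_i \sum_j (a i * b j - a j * b i) ^+ 2 =
  \sum_i \sum_j a i ^+ 2 * b j ^+ 2 + \sum_i \sum_j b i ^+ 2 * a j ^+ 2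
   - \sum_i \sum_j 2 * (a i * b i) * (a j * b j).
  rewrite -big_split -sumrB; apply: eq_bigr => i _ /=.
  by rewrite -big_split -sumrB; apply: eq_bigr => j _ /=; ring.
rewrite !mulr_suml.
under [X in _ = X + _ - _]eq_bigr do rewrite -mulr_sumr.
under [X in _ = _ + X - _]eq_bigr do rewrite -mulr_sumr.
under [X in _ = _ + _ - X]eq_bigr do rewrite -mulr_sumr.
rewrite -!mulr_suml -mulr_sumr.
by ring.
Qed.

Lemma sqr_sum_le d (a : 'I_d -> R) : (\sum_i a i) ^+ 2 <= d%:R * \sum_i a i ^+ 2.
Proof.
have := cauchy_schwarz_sum (fun=> 1) a.
under eq_bigr do rewrite mul1r.
under [X in _ <= X * _]eq_bigr do rewrite expr1n.
by rewrite sumr_const card_ord.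
Qed.

(* For [v = u + (tau/h) (N Lap + f.grad) + tau B] in lattice units: the viscosity
   [N >= 1] produces the gradient sum on the left, which absorbs the transport term;
   [Q] is the gradient sum of the previous iterate. *)
Lemma energy_point d (N K beta Q tau h u B : R) (p m f : 'I_d -> R) :
  1 <= N -> 0 < tau -> 0 < h -> 0 < beta -> 0 <= Q ->
  (forall i, `|f i| <= K) -> (forall i, `|f i| <= 2 * N) ->
  128 * d%:R * N ^+ 2 * tau <= h -> 64 * beta * tau <= h ->
  h ^+ 2 * B ^+ 2 <= beta * Q ->
  (u + tau / h * (\sum_i (N * (p i + m i) + f i * (p i - m i) / 2)) + tau * B) ^+ 2
   + tau / h / 2 * (\sum_i (p i ^+ 2 + m i ^+ 2))
  <= (1 + tau / h * (4 * d%:R * K ^+ 2 + 32 * beta)) * u ^+ 2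
     + tau / h * N * (\sum_i ((u + p i) ^+ 2 + (u + m i) ^+ 2))
     + tau / h / 16 * Q.
Proof.
move=> N1 t0 h0 b0 Q0 fK fN CFL1 CFL2 hB.
set s := tau / h; set y := h * B.
have s0 : 0 < s by rewrite divr_gt0.
have -> : tau * B = s * y by rewrite /s /y mulrA divfK // gt_eqF.
set X := \sum_i _; set P := \sum_i (p i ^+ 2 + m i ^+ 2).
set S := \sum_i ((u + p i) ^+ 2 + (u + m i) ^+ 2).
have P0 : 0 <= P by apply: sumr_ge0 => i _; rewrite addr_ge0 ?sqr_ge0.
have hs1 : 128 * d%:R * N ^+ 2 * s <= 1 by rewrite /s mulrA ler_pdivrMr // mul1r.
have hs2 : 64 * beta * s <= 1 by rewrite /s mulrA ler_pdivrMr // mul1r.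
have hy : y ^+ 2 <= beta * Q by rewrite /y exprMn.
have HX : X = N * (\sum_i (p i + m i)) + (\sum_i f i * (p i - m i)) / 2.
  by rewrite /X big_split /= mulr_sumr mulr_suml.
(* Completing the square turns the viscous term into neighbour squares [S] minus the dissipation
   [P]. *)
have HS : S = d%:R * 2 * u ^+ 2 + 2 * u * (\sum_i (p i + m i)) + P.
  rewrite /S /P mulr_sumr -[d in d%:R]card_ord -mulrA mulr_natl.
  rewrite -sumr_const -!big_split /=.
  by apply: eq_bigr => i _; ring.
have HF : u * (\sum_i f i * (p i - m i)) <= 4 * d%:R * K ^+ 2 * u ^+ 2 + P / 8.
  have -> : 4 * d%:R * K ^+ 2 * u ^+ 2 + P / 8 =
     \sum_(i < d) (4 * K ^+ 2 * u ^+ 2 + (p i ^+ 2 + m i ^+ 2) / 8).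
    rewrite big_split /= sumr_const card_ord /P mulr_suml -mulr_natl; congr (_ + _).
    by ring.
  rewrite mulr_sumr; apply: ler_sum => i _.
  have fK2 : f i ^+ 2 <= K ^+ 2.
    rewrite -[f i ^+ 2]real_normK ?num_real // ler_sqr ?nnegrE //.
    exact: le_trans (fK i).
  have H : f i ^+ 2 * u ^+ 2 <= K ^+ 2 * u ^+ 2 by rewrite ler_wpM2r ?sqr_ge0.
  have := sqr_ge0 (4 * (f i * u) - p i); have := sqr_ge0 (4 * (f i * u) + m i).
  nra.
have HX2 : X ^+ 2 <= 4 * d%:R * N ^+ 2 * P.
  apply: le_trans (sqr_sum_le _) _.
  rewrite (mulrC 4) -2!mulrA ler_wpM2l // mulrA /P mulr_sumr.
  apply: ler_sum => i _.
  have fN2 : f i ^+ 2 <= 4 * N ^+ 2.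
    have -> : 4 * N ^+ 2 = (2 * N) ^+ 2 by ring.
    rewrite -[f i ^+ 2]real_normK ?num_real // ler_sqr ?nnegrE //.
    exact: le_trans (fN i).
  (* Two-term Cauchy-Schwarz for [(N + f/2) p + (N - f/2) m]: the squared coefficients add up to
     [2 N^2 + f^2 / 2 <= 4 N^2]. *)
  have H := sqr_ge0 ((N + f i / 2) * m i - (N - f i / 2) * p i).
  have H2 : (f i ^+ 2) * (p i ^+ 2 + m i ^+ 2) <= 4 * N ^+ 2 * (p i ^+ 2 + m i ^+ 2).
    by rewrite ler_wpM2r // addr_ge0 ?sqr_ge0.
  nra.
have Hy1 : 2 * u * y <= 32 * beta * u ^+ 2 + Q / 32.
  rewrite -(ler_pM2l b0).
  have := sqr_ge0 (32 * beta * u - y); nra.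
have sX : s * X ^+ 2 <= P / 32.
  have : s * X ^+ 2 <= s * (4 * d%:R * N ^+ 2 * P) by rewrite ler_pM2l.
  have : (128 * d%:R * N ^+ 2 * s) * P <= 1 * P by rewrite ler_wpM2r.
  nra.
have sy : s * y ^+ 2 <= Q / 64.
  have : s * y ^+ 2 <= s * (beta * Q) by rewrite ler_pM2l.
  have : (64 * beta * s) * Q <= 1 * Q by rewrite ler_wpM2r.
  nra.
have sXy : s * (X + y) ^+ 2 <= 2 * (s * X ^+ 2) + 2 * (s * y ^+ 2).
  have : s * (X + y) ^+ 2 <= s * (2 * X ^+ 2 + 2 * y ^+ 2).
    by rewrite ler_pM2l //; have := sqr_ge0 (X - y); nra.
  lra.
have NP : P <= N * P by rewrite ler_peMl.
have du0 : 0 <= N * (d%:R * 2 * u ^+ 2).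
  by apply: mulr_ge0; [exact: le_trans N1 | rewrite mulr_ge0 ?sqr_ge0 // mulr_ge0].
set F := \sum_i f i * (p i - m i) in HX HF.
set L := \sum_i (p i + m i) in HX HS.
(* Budget: out of the dissipation [P], transport takes [P/8], the squared increment [2 * P/32], and
   [P/2] stays on the left. The source costs [Q/32 + 2 * Q/64 = Q/16]. *)
have key : 2 * u * X + 2 * u * y + s * (X + y) ^+ 2 + P / 2 <=
    (4 * d%:R * K ^+ 2 + 32 * beta) * u ^+ 2 + N * S + Q / 16.
  have -> : 2 * u * X = N * (2 * u * L) + u * F by rewrite HX; field.
  rewrite HS; lra.
have := key; rewrite -(ler_pM2l s0); lra.
Qed.

End FiniteSums.

(** * Weighted sums over the lattice with values in the extended reals *)

Section WeightedSums.
Context {R : realType}.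

(** One inequality is checked on finite partial sums; the other is the same inequality for [r^-1],
    with [r = 0] treated apart. *)
Lemma esumZl (T : choiceType) (r : R) (a : T -> \bar R) :
  0 <= r -> (forall i, (0 <= a i)%E) ->
  (\esum_(i in [set: T]) (r%:E * a i) = r%:E * \esum_(i in [set: T]) a i)%E.
Proof.
have le_Z (r' : R) (b : T -> \bar R) : 0 <= r' -> (forall i, (0 <= b i)%E) ->
    (\esum_(i in [set: T]) (r'%:E * b i) <= r'%:E * \esum_(i in [set: T]) b i)%E.
  move=> r0 b0; apply: ge_ereal_sup => _ [X [finX XI]] <-.
  rewrite -ge0_mule_fsumr //.
  by apply: lee_wpmul2l; rewrite ?lee_fin // esum_ge //; exists X.
rewrite le_eqVlt => /predU1P[<-|r0] a0.
  by rewrite mul0e esum1 // => i _; rewrite mul0e.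
apply/eqP; rewrite eq_le le_Z ?(ltW r0) //=.
rewrite -lee_pdivlMl // -[leRHS]/(_%:E * _)%E.
apply: le_trans (le_Z r^-1 (fun i => (r%:E * a i)%E) _ _).
- by apply: le_esum => i _; rewrite muleA -EFinM mulVf ?mul1e // gt_eqF.
- by rewrite invr_ge0 ltW.
- by move=> i; rewrite mule_ge0 // lee_fin ltW.
Qed.

Definition wsum {d} (w g : 'rV[int]_d -> R) : \bar R :=
  \esum_(k in [set: 'rV[int]_d]) (w k * g k)%:E.

Context {d : nat} (w : 'rV[int]_d -> R).
Hypothesis w0 : forall k, 0 <= w k.

Lemma wsum_ge0 (g : 'rV[int]_d -> R) : (forall k, 0 <= g k) -> (0 <= wsum w g)%E.
Proof. by move=> g0; apply: esum_ge0 => k _; rewrite lee_fin mulr_ge0. Qed.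

Lemma le_wsum (g g' : 'rV[int]_d -> R) : (forall k, g k <= g' k) -> (wsum w g <= wsum w g')%E.
Proof. by move=> gg; apply: le_esum => k _; rewrite lee_fin ler_wpM2l. Qed.

Lemma wsumD (g g' : 'rV[int]_d -> R) : (forall k, 0 <= g k) -> (forall k, 0 <= g' k) ->
  wsum w (fun k => (g k + g' k)%R) = (wsum w g + wsum w g')%E.
Proof.
move=> g0 g'0; rewrite /wsum -esumD.
- by apply: eq_esum => k _; rewrite mulrDr EFinD.
- by move=> k _; rewrite lee_fin mulr_ge0.
- by move=> k _; rewrite lee_fin mulr_ge0.
Qed.

Lemma wsumZ (r : R) (g : 'rV[int]_d -> R) : 0 <= r -> (forall k, 0 <= g k) ->
  wsum w (fun k => (r * g k)%R) = (r%:E * wsum w g)%E.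
Proof.
move=> r0 g0; rewrite /wsum -esumZl //.
  by apply: eq_esum => k _; rewrite mulrCA EFinM.
by move=> k; rewrite lee_fin mulr_ge0.
Qed.

Lemma wsum_sum (I : finType) (g : I -> 'rV[int]_d -> R) :
  (forall i k, 0 <= g i k) ->
  wsum w (fun k => (\sum_i g i k)%R) = (\sum_i wsum w (g i))%E.
Proof.
move=> g0; rewrite /wsum -esum_sum.
  by apply: eq_esum => k _; rewrite mulr_sumr -sumEFin.
by move=> k i _ _; rewrite lee_fin mulr_ge0.
Qed.

(** The substitution [k -> k - e] moves the translation from [g] onto the weight. *)
Lemma wsum_shift (e : 'rV[int]_d) (g : 'rV[int]_d -> R) :
  (forall k, w (k - e) <= 3 * w k) -> (forall k, 0 <= g k) ->
  (wsum w (fun k => (g (k + e))%R) <= 3%:E * wsum w g)%E.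
Proof.
move=> we g0.
rewrite /wsum (@reindex_esum _ _ _ [set: 'rV[int]_d] _ (fun k => (k - e)%R)); last first.
  split => // [x y _ _ /addIr //|k _]; exists (k + e) => //.
  by rewrite addrK.
rewrite -esumZl //; last by move=> k; rewrite lee_fin mulr_ge0.
apply: le_esum => k _; rewrite -EFinM lee_fin subrK mulrA.
by rewrite ler_wpM2r.
Qed.

End WeightedSums.

(** * Weighted energy inequality for one time step *)

Section EnergyStep.
Context {R : realType} {d : nat}.
Implicit Types (u : 'rV[int]_d -> R).

Lemma enorm_sqr n (v : 'rV[R]_n) : enorm v ^+ 2 = \sum_(i < n) v 0 i ^+ 2.
Proof. by rewrite sqr_sqrtr // sumr_ge0 // => i _; exact: sqr_ge0. Qed.

Lemma enorm_Dh_sqr (h : R) u k : enorm (Dh h u k) ^+ 2 =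
  (h ^+ 2)^-1 * \sum_i (u (k + ev i) - u k) ^+ 2.
Proof.
rewrite enorm_sqr mulr_sumr; apply: eq_bigr => i _.
by rewrite mxE exprMn exprVn mulrC.
Qed.

Variable (w : 'rV[int]_d -> R).
Hypothesis w0 : forall k, 0 <= w k.
Hypothesis wD : forall k i, w (k + ev i) <= 3 * w k.
Hypothesis wB : forall k i, w (k - ev i) <= 3 * w k.

Lemma wsum_neighbours u : (wsum w (fun k => (\sum_i
    (u (k + ev i) ^+ 2 + u (k - ev i) ^+ 2))%R)
  <= (6 * d%:R)%:E * wsum w (fun k => (u k ^+ 2)%R))%E.
Proof.
rewrite wsum_sum //; last by move=> i k; rewrite addr_ge0 ?sqr_ge0.
apply: (@le_trans _ _ (\sum_(i < d) (6%:E * wsum w (fun k => (u k ^+ 2)%R)))%E).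
  apply: lee_sum => i _.
  rewrite wsumD => //; do ?[by move=> k; exact: sqr_ge0].
  have -> : 6 = 3 + 3 :> R by lra.
  rewrite EFinD ge0_muleDl ?lee_fin //; apply: leeD.
    by apply: (@wsum_shift _ _ _ w0 (ev i) (fun k => u k ^+ 2)) => // k; exact: sqr_ge0.
  apply: (@wsum_shift _ _ _ w0 (- ev i) (fun k => u k ^+ 2)) => // k; last exact: sqr_ge0.
  by rewrite opprK.
rewrite -ge0_sume_distrr; last by move=> i _; apply: wsum_ge0 => // k; exact: sqr_ge0.
rewrite EFinM -muleA; apply: lee_wpmul2l; first by rewrite lee_fin.
by rewrite sumr_const card_ord mule_natl.
Qed.

(** Up to sign, a backward difference at [k] is the forward difference at [k - ev i]. *)
Lemma wsum_backward u :
  (wsum w (fun k => (\sum_i (u (k - ev i) - u k) ^+ 2)%R) <=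
   3%:E * wsum w (fun k => (\sum_i (u (k + ev i) - u k) ^+ 2)%R))%E.
Proof.
rewrite !wsum_sum; do ?[by move=> *; exact: sqr_ge0 | exact: w0].
rewrite ge0_sume_distrr; last by move=> i _; apply: wsum_ge0 => // k; exact: sqr_ge0.
apply: lee_sum => i _.
rewrite [X in (X <= _)%E](_ : _ =
    wsum w (fun k => ((u (k + - ev i + ev i) - u (k + - ev i)) ^+ 2)%R)); last first.
  by apply: eq_esum => k _; rewrite subrK -sqrrN opprB.
apply: (@wsum_shift _ _ _ w0 (- ev i) (fun k => (u (k + ev i) - u k) ^+ 2)) => k.
  by rewrite opprK.
exact: sqr_ge0.
Qed.

(** Sum of [energy_point] against [w]. In the application [u] and [v] are the new error at the later
    and the earlier time, and [z] is the previous error at the later time. The term [6 * d * N] in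
    the growth rate is the price of the neighbour squares. *)
Lemma energy_step (N K beta tau h : R) (u v z B : 'rV[int]_d -> R)
    (f : 'rV[int]_d -> 'I_d -> R) :
  1 <= N -> 0 < tau -> 0 < h -> 0 < beta ->
  (forall k i, `|f k i| <= K) -> (forall k i, `|f k i| <= 2 * N) ->
  128 * d%:R * N ^+ 2 * tau <= h -> 64 * beta * tau <= h ->
  (forall k, h ^+ 2 * B k ^+ 2 <= beta *
     (\sum_i ((z (k + ev i) - z k) ^+ 2 + (z (k - ev i) - z k) ^+ 2))) ->
  (forall k, v k = u k + tau / h * (\sum_i
     (N * ((u (k + ev i) - u k) + (u (k - ev i) - u k)) +
      f k i * ((u (k + ev i) - u k) - (u (k - ev i) - u k)) / 2)) + tau * B k) ->
  (wsum w (fun k => (v k ^+ 2)%R) +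
     (tau * h / 2)%:E * wsum w (fun k => (enorm (Dh h u k) ^+ 2)%R)
   <= (1 + tau / h * (4 * d%:R * K ^+ 2 + 32 * beta + 6 * d%:R * N))%:E
        * wsum w (fun k => (u k ^+ 2)%R)
      + (tau * h / 4)%:E * wsum w (fun k => (enorm (Dh h z k) ^+ 2)%R))%E.
Proof.
move=> N1 t0 h0 b0 fK fN CFL1 CFL2 hB hv.
have sqs (I : finType) (g : I -> R) : 0 <= \sum_i g i ^+ 2.
  by apply: sumr_ge0 => i _; exact: sqr_ge0.
have s0 : 0 < tau / h by rewrite divr_gt0.
have N0 : 0 <= N by lra.
set s := tau / h in s0 hv *.
pose F (x : 'rV[int]_d -> R) (k : 'rV[int]_d) := \sum_i (x (k + ev i) - x k) ^+ 2 : R.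
pose Bk (x : 'rV[int]_d -> R) (k : 'rV[int]_d) := \sum_i (x (k - ev i) - x k) ^+ 2 : R.
have F0 x k : 0 <= F x k by exact: sqs.
have Bk0 x k : 0 <= Bk x k by exact: sqs.
pose U := wsum w (fun k => (u k ^+ 2)%R).
have U0 : (0 <= U)%E by apply: wsum_ge0 => // k; exact: sqr_ge0.
have DE (r : R) x : 0 <= r -> ((r * h)%:E * wsum w (fun k => (enorm (Dh h x k) ^+ 2)%R) =
     (r / h)%:E * wsum w (F x))%E.
  move=> r0.
  have -> : (fun k => enorm (Dh h x k) ^+ 2) = (fun k => (h ^+ 2)^-1 * F x k).
    by apply/funext => k; rewrite enorm_Dh_sqr.
  rewrite wsumZ; [|exact: w0|by rewrite invr_ge0 sqr_ge0|exact: F0].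
  by rewrite muleA -EFinM; congr (_%:E * _)%E; field; rewrite gt_eqF.
rewrite (_ : tau * h / 2 = tau / 2 * h); last by ring.
rewrite (_ : tau * h / 4 = tau / 4 * h); last by ring.
rewrite !DE ?divr_ge0 ?(ltW t0) //.
pose a := 4 * d%:R * K ^+ 2 + 32 * beta.
have a0 : 0 <= a by rewrite addr_ge0 // mulr_ge0 ?sqr_ge0 ?(ltW b0) // mulr_ge0.
apply: (@le_trans _ _ (wsum w (fun k => ((1 + s * a) * u k ^+ 2 +
    ((s * N) * (\sum_i (u (k + ev i) ^+ 2 + u (k - ev i) ^+ 2)) +
     (s / 16) * (F z k + Bk z k)))%R))).
  rewrite -wsumZ //; last by rewrite !divr_ge0 ?(ltW t0) ?(ltW h0).
  rewrite -wsumD //; first last.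
  - by move=> k; rewrite mulr_ge0 // !divr_ge0 ?(ltW t0) ?(ltW h0).
  - by move=> k; exact: sqr_ge0.
  apply: le_wsum => // k.
  have FB0 : 0 <= F z k + Bk z k by rewrite addr_ge0.
  have hB' : h ^+ 2 * B k ^+ 2 <= beta * (F z k + Bk z k).
    by rewrite /F /Bk -big_split.
  have := @energy_point R d N K beta _ tau h (u k) (B k) _ _ _ N1 t0 h0 b0 FB0
    (fK k) (fN k) CFL1 CFL2 hB'.
  move=> /(_ (fun i => u (k + ev i) - u k) (fun i => u (k - ev i) - u k)).
  rewrite -hv.
  under [X in _ <= _ + tau / h * N * X + _]eq_bigr do rewrite !subrKC.
  rewrite -/s -/a big_split /= -/(F u k) -/(Bk u k) => H.
  (* Only the forward half of the dissipation is kept, the half that [Dh] measures. *)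
  have : 0 <= s / 2 * Bk u k by rewrite mulr_ge0 // divr_ge0 ?(ltW s0).
  have -> : tau / 2 / h = s / 2 by rewrite /s; ring.
  lra.
have sN0 : 0 <= s * N by rewrite mulr_ge0 // ltW.
have nb0 k : 0 <= \sum_i (u (k + ev i) ^+ 2 + u (k - ev i) ^+ 2).
  by apply: sumr_ge0 => i _; rewrite addr_ge0 ?sqr_ge0.
have FB0 k : 0 <= F z k + Bk z k by rewrite addr_ge0.
have sa0 : 0 <= 1 + s * a by rewrite addr_ge0 // mulr_ge0 // ltW.
have s16 : 0 <= s / 16 by rewrite divr_ge0 // ltW.
rewrite wsumD //; first last.
- by move=> k; rewrite addr_ge0 // mulr_ge0.
- by move=> k; rewrite mulr_ge0 // sqr_ge0.
rewrite wsumD //; do ?[by move=> k; rewrite mulr_ge0].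
rewrite !wsumZ //; last by move=> k; exact: sqr_ge0.
rewrite (wsumD w0 (F0 z) (Bk0 z)) addeA; apply: leeD.
  rewrite -/U (_ : 1 + s * (a + _) = (1 + s * a) + s * N * (6 * d%:R)); last by ring.
  rewrite (EFinD (1 + s * a)) ge0_muleDl ?lee_fin //; last by rewrite mulr_ge0.
  apply: leeD => //; rewrite [(s * N * _)%:E]EFinM -muleA.
  by apply: lee_wpmul2l; rewrite ?lee_fin // wsum_neighbours.
rewrite (_ : tau / 4 / h = s / 16 * 4); last by rewrite /s; field; rewrite gt_eqF.
rewrite [(s / 16 * 4)%:E]EFinM -muleA; apply: lee_wpmul2l; rewrite ?lee_fin //.
have -> : 4 = 1 + 3 :> R by lra.
rewrite EFinD ge0_muleDl ?lee_fin // mul1e; apply: leeD => //.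
exact: wsum_backward.
Qed.

End EnergyStep.

(** * Induction over time steps and iterations *)

Section EnergyInduction.
Context {R : realType}.

(** Backward induction in time gives [E n.+1 j + c * S n.+1 j <= c / 2 * S n j]. Dropping [E] halves
    [S] at each iteration; [E] is kept only at the last one. *)
Lemma energy_induction (E D : nat -> nat -> \bar R) (rho c : R) (M : nat) :
  0 <= rho -> 0 <= c -> (forall n j, (0 <= D n j)%E) -> (forall n j, (0 <= E n j)%E) ->
  (forall n, E n M = 0%E) ->
  (forall n j, (j < M)%N -> (E n.+1 j + c%:E * D n.+1 j.+1 <=
      rho%:E * E n.+1 j.+1 + (c / 2)%:E * D n j.+1)%E) ->
  forall n j, (j <= M)%N ->
  (E n.+1 j <= (c / 2 ^+ n.+1)%:E *
     \sum_(j.+1 <= s < M.+1) (rho ^+ (s - j.+1)%N)%:E * D 0%N s)%E.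
Proof.
move=> rho0 c0 D0 E0 EM step.
(* The dissipation of the step from [j.+1] to [j] lives at time [j.+1]. With the power [s - j.+1]
   one has [S n j = D n j.+1 + rho * S n j.+1], which matches the factor [rho] in front of [E]. *)
pose S (n j : nat) : \bar R := (\sum_(j.+1 <= s < M.+1) (rho ^+ (s - j.+1)%N)%:E * D n s)%E.
have S0 n j : (0 <= S n j)%E.
  by apply: sume_ge0 => s _; rewrite mule_ge0 // lee_fin exprn_ge0.
have Srec n j : (j < M)%N -> S n j = (D n j.+1 + rho%:E * S n j.+1)%E.
  move=> jM; rewrite /S big_ltn // subnn expr0 mul1e; congr (_ + _)%E.
  rewrite ge0_sume_distrr; last by move=> s _; rewrite mule_ge0 // lee_fin exprn_ge0.
  rewrite !big_nat; apply: eq_bigr => s /andP[js _].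
  by rewrite muleA -EFinM -exprS -subSn // subSS.
have main n i : (i <= M)%N ->
    (E n.+1 (M - i)%N + c%:E * S n.+1 (M - i)%N <= (c / 2)%:E * S n (M - i)%N)%E.
  elim: i => [_|i IH iM].
    by rewrite subn0 EM /S !big_geq // !mule0 add0e.
  have jM : (M - i.+1 < M)%N by rewrite ltn_subrL (leq_ltn_trans _ iM).
  have jE : (M - i.+1).+1 = (M - i)%N by rewrite -subSn // subSS.
  have := step n _ jM; rewrite !(Srec _ _ jM) jE => st.
  have {}IH := IH (ltnW iM).
  move: (M - i.+1)%N (M - i)%N st IH => j j' st IH.
  rewrite !ge0_muleDr ?mule_ge0 ?lee_fin // addeA.
  apply: le_trans (leeD2r _ st) _.
  rewrite -addeA addeC -addeA; apply: leeD2l.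
  rewrite addeC muleCA -ge0_muleDr ?mule_ge0 ?lee_fin // [leRHS]muleCA.
  by apply: lee_wpmul2l; rewrite ?lee_fin.
move=> n j jM.
have half i : (0 < i)%N -> forall j', (j' <= M)%N ->
    (c%:E * S i j' <= (c / 2 ^+ i)%:E * S 0%N j')%E.
  case: i => // i _ j' j'M; elim: i => [|i IH].
    rewrite expr1; have := main 0%N _ (leq_subr j' M); rewrite subKn //.
    by apply: le_trans; rewrite leeDr.
  have := main i.+1 _ (leq_subr j' M); rewrite subKn // => H.
  apply: le_trans (le_trans H _); first by rewrite leeDr.
  rewrite (_ : c / 2 = 2^-1 * c); last by rewrite mulrC.
  rewrite (_ : c / 2 ^+ i.+2 = 2^-1 * (c / 2 ^+ i.+1)); last first.
    by rewrite exprS invfM; ring.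
  by rewrite !(EFinM 2^-1) -!muleA; apply: lee_wpmul2l; rewrite ?lee_fin ?invr_ge0.
have := main n _ (leq_subr j M); rewrite subKn // => H.
apply: le_trans (le_trans H _).
  by rewrite leeDl // mule_ge0 ?lee_fin.
case: n {H} => [|n]; first by rewrite expr1.
rewrite (_ : c / 2 = 2^-1 * c); last by rewrite mulrC.
rewrite (_ : c / 2 ^+ n.+2 = 2^-1 * (c / 2 ^+ n.+1)); last first.
  by rewrite exprS invfM; ring.
rewrite !(EFinM 2^-1) -!muleA; apply: lee_wpmul2l; rewrite ?lee_fin ?invr_ge0 //.
exact: half.
Qed.

End EnergyInduction.

(** * Euclidean norm, the exponential weight and its total mass *)

Section Weight.
Context {R : realType}.

Lemma enorm_ge0 n (v : 'rV[R]_n) : 0 <= enorm v.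
Proof. exact: sqrtr_ge0. Qed.

Lemma dotp_le n (u v : 'rV[R]_n) : `|dotp u v| <= enorm u * enorm v.
Proof.
rewrite -ler_sqr ?nnegrE ?mulr_ge0 ?enorm_ge0 // real_normK ?num_real //.
by rewrite exprMn !enorm_sqr; exact: cauchy_schwarz_sum.
Qed.

Lemma enormD n (u v : 'rV[R]_n) : enorm (u + v) <= enorm u + enorm v.
Proof.
rewrite -ler_sqr ?nnegrE ?addr_ge0 ?enorm_ge0 // sqrrD !enorm_sqr.
have -> : \sum_(i < n) (u + v) 0 i ^+ 2 =
    \sum_(i < n) u 0 i ^+ 2 + dotp u v *+ 2 + \sum_(i < n) v 0 i ^+ 2.
  rewrite /dotp -mulr_natl mulr_sumr -!big_split /=.
  by apply: eq_bigr => i _; rewrite !mxE; ring.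
rewrite lerD2r lerD2l ler_wMn2r //.
exact: le_trans (ler_norm _) (dotp_le _ _).
Qed.

Lemma norm_le_enorm n (v : 'rV[R]_n) i : `|v 0 i| <= enorm v.
Proof.
rewrite -ler_sqr ?nnegrE ?enorm_ge0 // real_normK ?num_real // enorm_sqr.
by rewrite (bigD1 i) //= lerDl sumr_ge0 // => j _; exact: sqr_ge0.
Qed.

Lemma enorm_le_const n (v : 'rV[R]_n) (a : R) : 0 <= a ->
  (forall i, `|v 0 i| <= a) -> enorm v <= n%:R * a.
Proof.
move=> a0 va; rewrite -ler_sqr ?nnegrE ?enorm_ge0 ?mulr_ge0 // enorm_sqr.
apply: (@le_trans _ _ (\sum_(i < n) a ^+ 2)).
  by apply: ler_sum => i _; rewrite -[v 0 i ^+ 2]real_normK ?num_real // ler_sqr ?nnegrE.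
rewrite sumr_const card_ord exprMn -[_ *+ _]mulr_natl ler_wpM2r ?sqr_ge0 //.
by rewrite -natrX ler_nat; case: n {v va} => // n; rewrite leq_pmulr.
Qed.

Lemma sum_le_enorm n (v : 'rV[R]_n) : \sum_i `|v 0 i| <= n%:R * enorm v.
Proof.
rewrite -[n in n%:R]card_ord mulr_natl -sumr_const.
by apply: ler_sum => i _; exact: norm_le_enorm.
Qed.

Lemma enorm_pt_ev d (h : R) (i : 'I_d) : 0 <= h -> enorm (pt h (ev i)) = h.
Proof.
move=> h0; rewrite /enorm (bigD1 i) //= big1 => [|j ji].
  by rewrite !mxE !eqxx mulr1 addr0 sqrtr_sqr ger0_norm.
by rewrite !mxE eqxx (negPf ji) mulr0 expr0n.
Qed.

Lemma ptD d (h : R) (k k' : 'rV[int]_d) : pt h (k + k') = pt h k + pt h k'.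
Proof. by apply/rowP => i; rewrite !mxE intrD mulrDr. Qed.

(** From [exp(-1/6) >= 5/6] one gets [e <= (6/5)^6 < 3]. *)
Lemma expR1_le3 : expR 1 <= 3 :> R.
Proof.
have -> : 1 = 6%:R * 6^-1 :> R by rewrite mulfV.
rewrite expRM_natl.
have H : expR 6^-1 <= 6 / 5 :> R.
  have := @expR_ge1Dx R (- 6^-1); rewrite expRN => H.
  have : (1 - 6^-1) * expR 6^-1 <= 1 :> R.
    by rewrite -ler_pdivlMr ?expR_gt0 // mul1r.
  lra.
apply: (@le_trans _ _ ((6 / 5) ^+ 6)); last by lra.
by rewrite lerXn2r ?nnegrE ?expR_ge0 // divr_ge0.
Qed.

Definition weight d (h r : R) (k : 'rV[int]_d) : R :=
  Num.min 1 (expR (- enorm (pt h k) + r + 1)).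

Lemma weight_ge0 d h r (k : 'rV[int]_d) : 0 <= weight h r k.
Proof. by rewrite le_min ler01 expR_ge0. Qed.

Lemma weight1 d h r (k : 'rV[int]_d) : enorm (pt h k) <= r -> weight h r k = 1.
Proof.
move=> kr; rewrite /weight min_l // -[leLHS]expR0 ler_expR; lra.
Qed.

Lemma weight_lip d h r (k k' : 'rV[int]_d) :
  enorm (pt h k) <= enorm (pt h k') + 1 -> weight h r k' <= 3 * weight h r k.
Proof.
move=> kk'; rewrite /weight minr_pMr //.
rewrite le_min; apply/andP; split.
  by rewrite ge_min; apply/orP; left; lra.
rewrite ge_min; apply/orP; right.
apply: (@le_trans _ _ (expR 1 * expR (- enorm (pt h k) + r + 1))).
  rewrite -expRD ler_expR; lra.
by rewrite ler_wpM2r ?expR_ge0 // expR1_le3.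
Qed.

Lemma weightD d h r (k : 'rV[int]_d) i : 0 < h < 1 ->
  weight h r (k + ev i) <= 3 * weight h r k.
Proof.
move=> /andP[h0 h1]; apply: weight_lip.
have -> : pt h k = pt h (k + ev i) + pt h (- ev i) by rewrite -ptD addrK.
apply: le_trans (enormD _ _) _; rewrite lerD2l.
have -> : enorm (pt h (- ev i)) = enorm (pt h (ev i)).
  by congr Num.sqrt; apply: eq_bigr => j _; rewrite !mxE rmorphN mulrN sqrrN.
by rewrite enorm_pt_ev ltW.
Qed.

Lemma weightB d h r (k : 'rV[int]_d) i : 0 < h < 1 ->
  weight h r (k - ev i) <= 3 * weight h r k.
Proof.
move=> /andP[h0 h1]; apply: weight_lip.
have -> : pt h k = pt h (k - ev i) + pt h (ev i) by rewrite -ptD subrK.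
by apply: le_trans (enormD _ _) _; rewrite lerD2l enorm_pt_ev ltW.
Qed.

(** Slowing the decay from [e^(-|x|)] to [e^(-|x|/r)] keeps the prefactor [e^2] free of [r]; the
    direct bound would cost [e^(r+1)] and spoil the growth [r^d]. The comparison with the l1 norm
    then gives a product over the coordinates. *)
Lemma weight_le_prod d h r (k : 'rV[int]_d) : (0 < d)%N -> 0 < h -> 1 <= r ->
  weight h r k <= expR 2 * \prod_i expR (- (h / (d%:R * r))) ^+ absz (k 0 i).
Proof.
move=> d0 h0 r1; have r0 : 0 < r by apply: lt_le_trans r1.
have d0' : 0 < d%:R :> R by rewrite ltr0n.
apply: (@le_trans _ _ (expR (2 - enorm (pt h k) / r))).
  (* Outside the ball the two exponents differ by [(|x| - r) * (r - 1) / r], which is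
     nonnegative. *)
  have [kr|kr] := leP (enorm (pt h k)) r.
    rewrite weight1 // -[leLHS]expR0 ler_expR.
    have : enorm (pt h k) / r <= 1 by rewrite ler_pdivrMr // mul1r.
    lra.
  rewrite ge_min; apply/orP; right; rewrite ler_expR.
  move: (enorm _) kr => x kr.
  rewrite -(ler_pM2r r0) [leRHS]mulrBl divfK ?gt_eqF //.
  nra.
rewrite expRD ler_wpM2l ?expR_ge0 //.
have -> : \prod_i expR (- (h / (d%:R * r))) ^+ absz (k 0 i) =
    expR (- ((\sum_i `|pt h k 0 i|) / d%:R / r)).
  under eq_bigr do rewrite -expRM_natl.
  rewrite -expR_sum !mulr_suml -sumrN; congr expR; apply: eq_bigr => i _.
  rewrite !mxE normrM (gtr0_norm h0) -intr_norm -abszE.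
  by rewrite -[_%:~R]/((absz (k 0 i))%:R); field; rewrite !gt_eqF.
rewrite ler_expR lerN2 ler_pM2r ?invr_gt0 // ler_pdivrMr // mulrC.
exact: sum_le_enorm.
Qed.

Lemma geometric_sum_le (r : R) n : 0 <= r < 1 -> \sum_(i < n) r ^+ i <= (1 - r)^-1.
Proof.
move=> /andP[r0 r1]; have r1' : 0 < 1 - r by rewrite subr_gt0.
rewrite -(ler_pM2l r1') mulfV ?gt_eqF // -opprB mulNr -subrX1 opprB.
by rewrite lerBlDr lerDl exprn_ge0.
Qed.

(** Encoding each coordinate by its sign and absolute value embeds the points into a full product of
    finite sets, over which the sum factors into [d] truncated geometric series, each counted
    twice. *)
Lemma prod_geometric_sum d (r : R) (s : seq 'rV[int]_d) : 0 <= r < 1 -> uniq s ->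
  \sum_(k <- s) \prod_i r ^+ absz (k 0 i) <= (2 / (1 - r)) ^+ d.
Proof.
move=> r01 us; have /andP[r0 r1] := r01.
pose B := (\max_(k <- s) \max_i absz (k 0%R i))%N.
pose phi (k : 'rV[int]_d) : {ffun 'I_d -> bool * 'I_B.+1} :=
  [ffun i => (0 <= k 0 i, inord (absz (k 0 i)))].
have kB k i : k \in s -> (absz (k 0%R i) < B.+1)%N.
  move=> ks; rewrite ltnS; apply: leq_trans (leq_bigmax_seq _ ks isT).
  exact: (leq_bigmax (F := fun i => absz (k 0 i))).
pose G (f : {ffun 'I_d -> bool * 'I_B.+1}) := \prod_i r ^+ (f i).2.
have -> : \sum_(k <- s) \prod_i r ^+ absz (k 0 i) = \sum_(f <- map phi s) G f.
  rewrite big_map big_seq [RHS]big_seq; apply: eq_bigr => k ks.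
  by apply: eq_bigr => i _; rewrite ffunE /= inordK ?kB.
have uphi : uniq (map phi s).
  rewrite map_inj_in_uniq // => k k' ks k's /ffunP kk'.
  apply/rowP => i; have := kk' i; rewrite !ffunE => -[sk /(congr1 val)].
  rewrite /= !inordK ?kB // => ak.
  move: sk ak; case: (lerP 0 (k 0 i)) => k0 /esym; case: (lerP 0 (k' 0 i)) => k'0 // _ ak.
    by rewrite -[LHS]gez0_abs // -[RHS]gez0_abs // ak.
  by apply: oppr_inj; rewrite -!ltz0_abs // ak.
rewrite big_uniq //.
apply: (@le_trans _ _ (\sum_f G f)).
  rewrite [leRHS](bigID (mem (map phi s))) /= lerDl.
  by apply: sumr_ge0 => f _; apply: prodr_ge0 => i _; rewrite exprn_ge0.
rewrite -(bigA_distr_bigA (fun (i : 'I_d) (x : bool * 'I_B.+1) => r ^+ x.2)) /=.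
rewrite prodr_const card_ord.
apply: lerXn2r; rewrite ?nnegrE ?divr_ge0 ?subr_ge0 ?(ltW r1) //.
  by apply: sumr_ge0 => x _; rewrite exprn_ge0.
rewrite -(pair_bigA _ (fun (b : bool) (n : 'I_B.+1) => r ^+ n)) /=.
by rewrite big_bool /=; have := geometric_sum_le B.+1 r01; lra.
Qed.

(** Source of [r^d] and of a factor [h^-d]: the coordinate ratio is [e^(-y)] with
    [y = h / (d r) <= 1], and [1 - e^(-y) >= y / 2]. *)
Lemma esum_weight_le d h r : (0 < d)%N -> 0 < h < 1 -> 1 <= r ->
  (\esum_(k in [set: 'rV[int]_d]) (weight h r k)%:E <=
    (expR 2 * (4 * d%:R * r / h) ^+ d)%:E)%E.
Proof.
move=> d0 /andP[h0 h1] r1; have r0 : 0 < r by apply: lt_le_trans r1.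
have d1' : 1 <= d%:R :> R by rewrite ler1n.
have d0' : 0 < d%:R :> R by rewrite ltr0n.
set y := h / (d%:R * r).
have dr1 : 1 <= d%:R * r by rewrite (le_trans r1) // ler_peMl // ltW.
have y0 : 0 < y by rewrite divr_gt0 // mulr_gt0.
have y1 : y <= 1.
  by rewrite ler_pdivrMr ?mulr_gt0 // mul1r (le_trans (ltW h1)).
have q1 : expR (- y) < 1 by rewrite -[ltRHS]expR0 ltr_expR oppr_lt0.
apply: ge_ereal_sup => _ [X [finX _]] <-.
rewrite fsbig_finite //= sumEFin lee_fin.
pose g (k : 'rV[int]_d) : R := expR 2 * \prod_i expR (- y) ^+ absz (k 0 i).
have := finmap.fset_uniq (fset_set X); move: (finmap.enum_fset _) => s us.
apply: (@le_trans _ _ (\sum_(k <- s) g k)).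
  by apply: ler_sum => k _; exact: weight_le_prod.
rewrite -mulr_sumr ler_wpM2l ?expR_ge0 //.
apply: le_trans (prod_geometric_sum _ _) _; rewrite ?expR_ge0 ?q1 //.
have q1' : 0 < 1 - expR (- y) by rewrite subr_gt0.
apply: lerXn2r; rewrite ?nnegrE ?divr_ge0 ?mulr_ge0 ?(ltW h0) ?(ltW r0) ?(ltW q1') //.
have -> : 4 * d%:R * r / h = 4 / y.
  by rewrite /y; field; rewrite !gt_eqF.
rewrite ler_pdivrMr // mulrAC ler_pdivlMr // expRN.
have := expR_ge1Dx y => ey.
have : (expR y)^-1 <= 1 - y / 2.
  rewrite -div1r ler_pdivrMr ?expR_gt0 //; nra.
lra.
Qed.

End Weight.

(** * The explicit step and its maximum principle *)

Section MonotoneScheme.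
Context {R : realType} {d : nat}.
Implicit Types (u v : 'rV[int]_d -> R) (phi : 'I_d -> R) (s N h tau : R).

(* One explicit backward step in lattice units ([s = tau / h]), without the source
   term; it is monotone in [u] as soon as [|phi i| <= 2 N] and [2 d N s <= 1]. *)
Definition stp s N phi u (k : 'rV[int]_d) : R := u k + s * (\sum_i
  (N * ((u (k + ev i) - u k) + (u (k - ev i) - u k)) +
   phi i * ((u (k + ev i) - u k) - (u (k - ev i) - u k)) / 2)).

Lemma stpE N tau h u (k : 'rV[int]_d) (F : 'rV[R]_d) : 0 < h ->
  stp (tau / h) N (F 0) u k =
  u k + tau * dotp (gradh h u k) F + tau * (N * h * laplh h u k).
Proof.
move=> h0; rewrite /stp -addrA; congr (_ + _).
rewrite /dotp /laplh !mulr_sumr -big_split /=; apply: eq_bigr => i _.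
by rewrite !mxE; field; rewrite gt_eqF.
Qed.

(** The spatial operators act at the later time, so the equation gives the earlier value [b]
    explicitly. *)
Lemma stp_of_equation N tau h u (k : 'rV[int]_d) (F : 'rV[R]_d) (x b : R) :
  0 < tau -> 0 < h ->
  (u k - b) / tau + x + dotp (gradh h u k) F = - (N * h) * laplh h u k ->
  b = stp (tau / h) N (F 0) u k + tau * x.
Proof.
move=> t0 h0 /(congr1 (fun y => tau * y)); rewrite !mulrDr mulrC divfK ?gt_eqF //.
by rewrite stpE //; lra.
Qed.

Lemma stpB s N phi u v k :
  stp s N phi (fun k => u k - v k) k = stp s N phi u k - stp s N phi v k.
Proof.
rewrite /stp; set a := \sum_i _; set b := \sum_i _; set c := \sum_i _.
suff -> : a = b - c by ring.
by rewrite /a /b /c -sumrB; apply: eq_bigr => i _; field.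
Qed.

Lemma stpN s N phi u k : stp s N phi (fun k => - u k) k = - stp s N phi u k.
Proof.
rewrite /stp; set a := \sum_i _; set b := \sum_i _.
suff -> : a = - b by ring.
by rewrite /a /b -sumrN; apply: eq_bigr => i _; field.
Qed.

Lemma stp_shift s N phi u (e k : 'rV[int]_d) :
  stp s N phi (fun k => u (k + e)) k = stp s N phi u (k + e).
Proof.
rewrite /stp; congr (_ + _ * _).
by apply: eq_bigr => i _; rewrite ![k + _ + e]addrAC.
Qed.

(** The new value is a convex combination: weights [s * (N + phi i / 2)] and [s * (N - phi i / 2)]
    on the neighbours, [1 - 2 * d * N * s] at the centre. *)
Lemma stp_le s N phi u k X : 0 <= s -> 2 * d%:R * N * s <= 1 ->
  (forall i, `|phi i| <= 2 * N) -> (forall k, u k <= X) -> stp s N phi u k <= X.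
Proof.
move=> s0 CFL phiN uX; rewrite /stp.
have uk0 : 0 <= X - u k by rewrite subr_ge0.
have H : \sum_i (N * ((u (k + ev i) - u k) + (u (k - ev i) - u k)) +
   phi i * ((u (k + ev i) - u k) - (u (k - ev i) - u k)) / 2) <=
   2 * d%:R * N * (X - u k).
  have -> : 2 * d%:R * N * (X - u k) = \sum_(i < d) 2 * N * (X - u k).
    by rewrite sumr_const card_ord -[RHS]mulr_natl; ring.
  apply: ler_sum => i _; have := phiN i; rewrite ler_norml => /andP[f1 f2].
  have a1 : 0 <= (N + phi i / 2) * (X - u (k + ev i)).
    by apply: mulr_ge0; [lra | rewrite subr_ge0].
  have a2 : 0 <= (N - phi i / 2) * (X - u (k - ev i)).
    by apply: mulr_ge0; [lra | rewrite subr_ge0].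
  lra.
have H1 := ler_wpM2l s0 H.
have H2 : (2 * d%:R * N * s) * (X - u k) <= 1 * (X - u k) by rewrite ler_wpM2r.
lra.
Qed.

Lemma stp_norm_le s N phi u k X : 0 <= s -> 2 * d%:R * N * s <= 1 ->
  (forall i, `|phi i| <= 2 * N) -> (forall k, `|u k| <= X) ->
  `|stp s N phi u k| <= X.
Proof.
move=> s0 CFL phiN uX; rewrite ler_norml; apply/andP; split.
  rewrite lerNl -stpN; apply: stp_le => // k'.
  by have := uX k'; rewrite ler_norml lerNl => /andP[].
by apply: stp_le => // k'; have := uX k'; rewrite ler_norml => /andP[].
Qed.

Lemma enorm_gradh_le h u k (z : R) : 0 < h -> 0 <= z ->
  (forall k i, `|u (k + ev i) - u k| <= z) -> enorm (gradh h u k) <= d%:R * (z / h).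
Proof.
move=> h0 z0 uz; apply: enorm_le_const => [|i]; first by rewrite divr_ge0 // ltW.
rewrite mxE normrM [`|_^-1|]gtr0_norm ?invr_gt0 ?mulr_gt0 //.
rewrite invfM mulrA ler_pM2r ?invr_gt0 // ler_pdivrMr //.
have -> : u (k + ev i) - u (k - ev i) =
   (u (k + ev i) - u k) + (u (k - ev i + ev i) - u (k - ev i)) by rewrite subrK; ring.
apply: le_trans (ler_normD _ _) _.
by have := uz k i; have := uz (k - ev i) i; lra.
Qed.

Lemma enorm_Dh_le h u k (z : R) : 0 < h -> 0 <= z ->
  (forall k i, `|u (k + ev i) - u k| <= z) -> enorm (Dh h u k) <= d%:R * (z / h).
Proof.
move=> h0 z0 uz; apply: enorm_le_const => [|i]; first by rewrite divr_ge0 // ltW.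
by rewrite mxE normrM [`|_^-1|]gtr0_norm ?invr_gt0 // ler_pM2r ?invr_gt0.
Qed.

Lemma enorm_gradh_sqr_le h u k : 0 < h ->
  h ^+ 2 * enorm (gradh h u k) ^+ 2 <=
  (\sum_i ((u (k + ev i) - u k) ^+ 2 + (u (k - ev i) - u k) ^+ 2)) / 2.
Proof.
move=> h0; rewrite enorm_sqr mulr_sumr mulr_suml; apply: ler_sum => i _.
rewrite mxE expr_div_n exprMn.
have -> : h ^+ 2 * ((u (k + ev i) - u (k - ev i)) ^+ 2 / (2 ^+ 2 * h ^+ 2)) =
   (u (k + ev i) - u (k - ev i)) ^+ 2 / 4 by field; rewrite gt_eqF.
have := sqr_ge0 (u (k + ev i) - u k + (u (k - ev i) - u k)); nra.
Qed.

Lemma gradhB h u v k :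
  gradh h u k - gradh h v k = gradh h (fun k => u k - v k) k.
Proof. by apply/rowP => i; rewrite !mxE; ring. Qed.

End MonotoneScheme.

Lemma backward_ind (P : nat -> Prop) (M : nat) : P M ->
  (forall j, (j < M)%N -> P j.+1 -> P j) -> forall j, (j <= M)%N -> P j.
Proof.
move=> PM PS j jM; rewrite -(subKn jM).
elim: (M - j)%N (leq_subr j M) => [|i IH] iM; first by rewrite subn0.
have lt : (M - i.+1 < M)%N by rewrite ltn_subrL (leq_ltn_trans _ iM).
by apply: PS => //; rewrite -subSn // subSS; apply: IH; exact: ltnW.
Qed.

(** The value at [b] is both a member and a lower bound of the set, so [inf] is a minimum. *)
Lemma Ham_attained (R : realType) (d m : nat) (A : set 'rV[R]_m)
    (c : R -> 'rV[R]_d -> 'rV[R]_m -> R)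
    (f : R -> 'rV[R]_d -> 'rV[R]_m -> 'rV[R]_d) (t : R) (x p : 'rV[R]_d) (b : 'rV[R]_m) :
  b \in A -> (forall a, a \in A -> a <> b ->
    c t x b + dotp p (f t x b) < c t x a + dotp p (f t x a)) ->
  Ham A c f t x p = c t x b + dotp p (f t x b) /\
  forall a, a \in A -> Ham A c f t x p <= c t x a + dotp p (f t x a).
Proof.
move=> bA bmin.
have bmin' a : a \in A -> c t x b + dotp p (f t x b) <= c t x a + dotp p (f t x a).
  by move=> aA; have [->|/eqP ab] := eqVneq a b => //; exact/ltW/bmin.
have HE : Ham A c f t x p = c t x b + dotp p (f t x b).
  apply/eqP; rewrite eq_le; apply/andP; split.
    apply: ge_inf; last by exists b => //; rewrite -inE.
    by exists (c t x b + dotp p (f t x b)) => _ [a Aa <-]; apply: bmin'; rewrite inE.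
  apply: lb_le_inf; first by exists (c t x b + dotp p (f t x b)), b => //; rewrite -inE.
  by move=> _ [a Aa <-]; apply: bmin'; rewrite inE.
by split=> // a aA; rewrite HE; exact: bmin'.
Qed.

Lemma ball_le_wsum (R : realType) (d : nat) (h r : R) (g : 'rV[int]_d -> R) :
  (forall k, 0 <= g k) ->
  (\esum_(k in [set k : 'rV[int]_d | (enorm (pt h k) <= r)%R]) (g k)%:E
   <= wsum (weight h r) g)%E.
Proof.
move=> g0; rewrite esum_mkcond; apply: le_esum => k _.
case: ifP => [|_]; last by rewrite lee_fin mulr_ge0 ?weight_ge0.
by rewrite inE /= => kr; rewrite weight1 // mul1r.
Qed.

(** * Bounds on the solutions of the two schemes and the error equation *)

Section Scheme.
Context {R : realType} {d m : nat}.
Variables (T K N tau h : R) (M : nat) (A : set 'rV[R]_m).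
Variables (c : R -> 'rV[R]_d -> 'rV[R]_m -> R)
  (f : R -> 'rV[R]_d -> 'rV[R]_m -> 'rV[R]_d) (q : 'rV[R]_d -> R)
  (alpha : R -> 'rV[R]_d -> 'rV[R]_d -> 'rV[R]_m)
  (alpha0 : R -> 'rV[R]_d -> 'rV[R]_m).
Variables (V : nat -> 'rV[int]_d -> R) (Vn : nat -> nat -> 'rV[int]_d -> R).

Hypotheses (K1 : 1 <= K) (N1 : 1 <= N) (t0 : 0 < tau) (h01 : 0 < h < 1).
Hypotheses (TM : T = M%:R * tau).
Hypothesis cfK : forall t x a, 0 <= t <= T -> a \in A ->
  `|c t x a| <= K /\ enorm (f t x a) <= K.
Hypothesis qK : forall x, `|q x| <= K.
Hypothesis cfL : forall t x x' a a', 0 <= t <= T -> a \in A -> a' \in A ->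
  `|c t x a - c t x' a'| <= K * (enorm (x - x') + enorm (a - a')) /\
  enorm (f t x a - f t x' a') <= K * (enorm (x - x') + enorm (a - a')).
Hypothesis qL : forall x x', `|q x - q x'| <= K * enorm (x - x').
Hypothesis alpha_min : forall t x p, 0 <= t <= T ->
  alpha t x p \in A /\ forall a, a \in A -> a <> alpha t x p ->
  c t x (alpha t x p) + dotp p (f t x (alpha t x p)) < c t x a + dotp p (f t x a).
Hypothesis alpha0A : forall t x, 0 <= t <= T -> alpha0 t x \in A.
Hypothesis alphaL : forall t x p p', 0 <= t <= T ->
  enorm (alpha t x p - alpha t x p') <= K * enorm (p - p').
Hypothesis fN : forall t x a, 0 <= t <= T -> a \in A -> enorm (f t x a) / 2 <= N.
Hypothesis HJB : forall j k, (1 <= j <= M)%N ->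
  (V j k - V j.-1 k) / tau + Ham A c f (tg tau j) (pt h k) (gradh h (V j) k)
  = - (N * h) * laplh h (V j) k.
Hypothesis VT : forall k, V M k = q (pt h k).
Hypothesis PI : forall n j k, (1 <= j <= M)%N ->
  (Vn n j k - Vn n j.-1 k) / tau
  + c (tg tau j) (pt h k) (policy tau h alpha alpha0 Vn n j k)
  + dotp (gradh h (Vn n j) k) (f (tg tau j) (pt h k) (policy tau h alpha alpha0 Vn n j k))
  = - (N * h) * laplh h (Vn n j) k.
Hypothesis VnT : forall n k, Vn n M k = q (pt h k).
Hypothesis CFL : 128 * d%:R * N ^+ 2 * tau <= h.

Let h0 : 0 < h. Proof. by case/andP: h01. Qed.
Let K0 : 0 < K. Proof. exact: lt_le_trans K1. Qed.
Let N0 : 0 < N. Proof. exact: lt_le_trans N1. Qed.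
Let s0 : 0 < tau / h. Proof. exact: divr_gt0. Qed.

Let tgT j : (j <= M)%N -> 0 <= tg tau j <= T.
Proof.
move=> jM; rewrite /tg mulr_ge0 ?(ltW t0) //= TM ler_pM2r //.
by rewrite ler_nat.
Qed.

Let TtgS j : T - tg tau j = T - tg tau j.+1 + tau.
Proof. by rewrite /tg -(natr1 j); ring. Qed.

Let Ttg0 j : (j <= M)%N -> 0 <= T - tg tau j.
Proof. by move=> /tgT /andP[_]; rewrite subr_ge0. Qed.

Let CFLs : 2 * d%:R * N * (tau / h) <= 1.
Proof.
rewrite mulrA ler_pdivrMr // mul1r; apply: le_trans CFL.
rewrite ler_pM2r //.
have : d%:R * N <= d%:R * N ^+ 2.
  by rewrite ler_wpM2l // expr2 ler_pMr.
have : 0 <= d%:R * N by rewrite mulr_ge0 // ltW.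
lra.
Qed.

Let f2N t x a i : 0 <= t <= T -> a \in A -> `|f t x a 0 i| <= 2 * N.
Proof.
move=> tT aA; apply: le_trans (norm_le_enorm _ i) _.
by have := fN x tT aA; rewrite ler_pdivrMr // mulrC.
Qed.

Let policyA n j k : (j <= M)%N -> policy tau h alpha alpha0 Vn n j k \in A.
Proof.
move=> jM; case: n => [|n] /=; first exact/alpha0A/tgT.
by case: (alpha_min (pt h k) (gradh h (Vn n j) k) (tgT jM)).
Qed.

Let opt j k := alpha (tg tau j) (pt h k) (gradh h (V j) k).

Let optA j k : (j <= M)%N -> opt j k \in A.
Proof. by move=> jM; case: (alpha_min (pt h k) (gradh h (V j) k) (tgT jM)). Qed.

Lemma V_step j k : (j < M)%N -> let a := opt j.+1 k in
  V j k = stp (tau / h) N (f (tg tau j.+1) (pt h k) a 0) (V j.+1) k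
          + tau * c (tg tau j.+1) (pt h k) a.
Proof.
move=> jM a; apply: stp_of_equation => //.
have [aA amin] := alpha_min (pt h k) (gradh h (V j.+1) k) (tgT jM).
have [HE _] := Ham_attained aA amin.
by have := @HJB j.+1 k; rewrite HE addrA; apply; rewrite jM.
Qed.

Lemma V_step_le j k a : (j < M)%N -> a \in A ->
  V j k <= stp (tau / h) N (f (tg tau j.+1) (pt h k) a 0) (V j.+1) k
          + tau * c (tg tau j.+1) (pt h k) a.
Proof.
move=> jM aA; rewrite V_step //= !stpE // -/(opt j.+1 k).
have [bA bmin] := alpha_min (pt h k) (gradh h (V j.+1) k) (tgT jM).
have [HE Hle] := Ham_attained bA bmin.
have := Hle _ aA; rewrite HE -/(opt j.+1 k) -(ler_pM2l t0) !mulrDr; lra.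
Qed.

Lemma Vn_step n j k : (j < M)%N -> let a := policy tau h alpha alpha0 Vn n j.+1 k in
  Vn n j k = stp (tau / h) N (f (tg tau j.+1) (pt h k) a 0) (Vn n j.+1) k
          + tau * c (tg tau j.+1) (pt h k) a.
Proof.
by move=> jM a; apply: stp_of_equation => //; apply: (@PI n j.+1 k); rewrite jM.
Qed.

(** By the maximum principle each step adds at most [tau * K] to the sup norm. *)
Lemma V_bounded j k : (j <= M)%N -> `|V j k| <= K * (1 + (T - tg tau j)).
Proof.
move=> jM; move: j jM k; apply: backward_ind => [k|j jM IH k].
  rewrite VT /tg -TM subrr addr0 mulr1; exact: qK.
rewrite V_step //= TtgS addrA mulrDr; apply: le_trans (ler_normD _ _) _.
apply: lerD.
  by apply: stp_norm_le => // [|i]; [exact: ltW | apply: f2N; [exact: tgT | exact: optA]].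
rewrite normrM gtr0_norm // mulrC ler_pM2r //.
by case: (cfK (pt h k) (tgT jM) (optA k jM)).
Qed.

Lemma Vn_bounded n j k : (j <= M)%N -> `|Vn n j k| <= K * (1 + (T - tg tau j)).
Proof.
move=> jM; move: j jM k; apply: backward_ind => [k|j jM IH k].
  rewrite VnT /tg -TM subrr addr0 mulr1; exact: qK.
rewrite Vn_step //= TtgS addrA mulrDr; apply: le_trans (ler_normD _ _) _.
apply: lerD.
  by apply: stp_norm_le => // [|i]; [exact: ltW | apply: f2N; [exact: tgT | exact: policyA]].
rewrite normrM gtr0_norm // mulrC ler_pM2r //.
by case: (cfK (pt h k) (tgT jM) (policyA n k jM)).
Qed.

(* The optimal control at [k] is used as a competitor at the shifted point. *)
Lemma V_shift_le j (e k : 'rV[int]_d) z : (j < M)%N -> enorm (pt h e) = h -> 0 <= z ->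
  (forall k, V j.+1 (k + e) - V j.+1 k <= z) ->
  (forall k i, `|V j.+1 (k + ev i) - V j.+1 k| <= z) ->
  V j (k + e) - V j k <= z * (1 + tau * (d%:R * K)) + tau * (K * h).
Proof.
move=> jM eh z0 ze zi.
have tT := tgT jM; set t := tg tau j.+1 in tT.
have aA := optA k jM; set a := opt j.+1 k in aA.
have := V_step_le (k + e) jM aA; have := V_step k jM; rewrite /= -/t -/a => -> .
set F' := f t (pt h (k + e)) a; set F := f t (pt h k) a.
have -> : stp (tau / h) N (F' 0) (V j.+1) (k + e) =
    stp (tau / h) N (F 0) (V j.+1) (k + e)
    + tau * dotp (gradh h (V j.+1) (k + e)) (F' - F).
  rewrite !stpE //.
  have -> : dotp (gradh h (V j.+1) (k + e)) (F' - F) =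
      dotp (gradh h (V j.+1) (k + e)) F' - dotp (gradh h (V j.+1) (k + e)) F.
    by rewrite /dotp -sumrB; apply: eq_bigr => i _; rewrite !mxE; ring.
  ring.
have S1 : stp (tau / h) N (F 0) (V j.+1) (k + e) - stp (tau / h) N (F 0) (V j.+1) k <= z.
  rewrite -stp_shift -stpB; apply: stp_le => //; first exact: ltW.
  by move=> i; exact: f2N.
have := cfL (pt h (k + e)) (pt h k) tT aA aA.
rewrite subrr (_ : enorm 0 = 0) ?addr0; last first.
  by rewrite /enorm big1 ?sqrtr0 // => i _; rewrite mxE expr0n.
have -> : pt h (k + e) - pt h k = pt h e by rewrite ptD addrAC subrr add0r.
rewrite eh -/F -/F' => -[cl fl].
(* The [1 / h] of this gradient bound cancels the [h] in the Lipschitz bound on the drift. *)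
have g1 := enorm_gradh_le (u := V j.+1) (k + e) h0 z0 zi.
have S2 : dotp (gradh h (V j.+1) (k + e)) (F' - F) <= z * (d%:R * K).
  apply: le_trans (ler_norm _) _; apply: le_trans (dotp_le _ _) _.
  apply: (@le_trans _ _ ((d%:R * (z / h)) * (K * h))).
    by apply: ler_pM; rewrite ?enorm_ge0.
  by rewrite le_eqVlt; apply/orP; left; apply/eqP; field; rewrite gt_eqF.
have S3 : c t (pt h (k + e)) a - c t (pt h k) a <= K * h.
  exact: le_trans (ler_norm _) cl.
have := ler_wpM2l (ltW t0) S2; have := ler_wpM2l (ltW t0) S3.
lra.
Qed.

(** Discrete Gronwall argument: a step multiplies the bound by [1 + tau * d * K] and adds
    [tau * K * h]. The addition is absorbed into the factor because the bound is never below
    [K * h], hence the rate [d * K + 1]. *)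
Lemma V_lipschitz j k i : (j <= M)%N ->
  `|V j (k + ev i) - V j k| <= K * h * expR ((d%:R * K + 1) * (T - tg tau j)).
Proof.
move=> jM; move: j jM k i; apply: backward_ind => [k i|j jM IH k i].
  rewrite !VT /tg -TM subrr mulr0 expR0 mulr1.
  apply: le_trans (qL _ _) _.
  by rewrite ptD addrAC subrr add0r enorm_pt_ev // ltW.
set z := K * h * expR ((d%:R * K + 1) * (T - tg tau j.+1)) in IH.
have zKh : K * h <= z.
  rewrite ler_peMr ?mulr_ge0 ?(ltW K0) ?(ltW h0) // -[leLHS]expR0 ler_expR.
  by rewrite mulr_ge0 ?Ttg0 // addr_ge0 // mulr_ge0 // ltW.
have z0 : 0 <= z by apply: le_trans zKh; rewrite mulr_ge0 ?ltW.
have B : z * (1 + tau * (d%:R * K)) + tau * (K * h) <=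
    K * h * expR ((d%:R * K + 1) * (T - tg tau j)).
  rewrite TtgS [(d%:R * K + 1) * _]mulrDr expRD [K * h * (_ * _)]mulrA -/z.
  apply: (@le_trans _ _ (z * (1 + (d%:R * K + 1) * tau))).
    by have := ler_wpM2l (ltW t0) zKh; lra.
  by rewrite ler_wpM2l // expR_ge1Dx.
have eh : enorm (pt h (ev i)) = h by rewrite enorm_pt_ev // ltW.
have eh' : enorm (pt h (- ev i)) = h.
  rewrite -[RHS]eh; congr Num.sqrt; apply: eq_bigr => l _.
  by rewrite !mxE rmorphN mulrN sqrrN.
apply: le_trans B; rewrite ler_norml; apply/andP; split.
  rewrite lerNl opprB.
  (* The lower bound is the one-sided estimate for the opposite shift, started from [k + ev i]. *)
  have := @V_shift_le j (- ev i) (k + ev i) z jM eh' z0; rewrite addrK; apply => //.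
  move=> k'; apply: le_trans (ler_norm _) _; rewrite distrC.
  by have := IH (k' - ev i) i; rewrite subrK.
apply: V_shift_le => // k'.
exact: le_trans (ler_norm _) (IH _ _).
Qed.

Lemma gradh_V_le j k : (j <= M)%N ->
  enorm (gradh h (V j) k) <= d%:R * K * expR ((d%:R * K + 1) * T).
Proof.
move=> jM; pose z := K * h * expR ((d%:R * K + 1) * T).
have z0 : 0 <= z by rewrite !mulr_ge0 ?expR_ge0 ?ltW.
have := @enorm_gradh_le _ _ h (V j) k z h0 z0.
have -> : d%:R * (z / h) = d%:R * K * expR ((d%:R * K + 1) * T).
  by rewrite /z; field; rewrite gt_eqF.
apply=> k' i; apply: le_trans (V_lipschitz _ _ jM) _.
rewrite ler_wpM2l ?mulr_ge0 ?(ltW h0) ?(ltW K0) // ler_expR.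
rewrite ler_wpM2l //; last by have /andP[] := tgT jM; lra.
by rewrite addr_ge0 // mulr_ge0 // ltW.
Qed.

Let G := gradsup M h V.

(** The supremum is an upper bound once the set is bounded, which the Lipschitz estimate ensures. *)
Lemma gradh_V_le_gradsup j k : (j <= M)%N -> enorm (gradh h (V j) k) <= G.
Proof.
move=> jM; apply: ub_le_sup; last by exists j, k.
exists (d%:R * K * expR ((d%:R * K + 1) * T)) => _ [j' [k' [j'M ->]]].
exact: gradh_V_le.
Qed.

Lemma gradsup_le : G <= d%:R * K * expR ((d%:R * K + 1) * T).
Proof.
apply: ge_sup; first by exists (enorm (gradh h (V 0%N) 0)), 0%N, 0.
by move=> _ [j' [k' [j'M ->]]]; exact: gradh_V_le.
Qed.

Lemma gradsup_ge0 : 0 <= G.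
Proof. exact: le_trans (enorm_ge0 _) (gradh_V_le_gradsup 0 (leq0n M)). Qed.

Let W n j k := Vn n j k - V j k.
(** [K^2] combines the Lipschitz constant of [alpha] with that of [c] and [f]; squaring gives [K^4].
    The 2 in [(1 + G)^2 <= 2 * (1 + G^2)] cancels the [1/2] gained when a central difference is
    split into one-sided ones. *)
Let beta := K ^+ 4 * (1 + G ^+ 2).

(* The two controls differ only through the gradients that they are computed from. *)
Lemma policy_error n j k : (j < M)%N -> exists2 B,
  h ^+ 2 * B ^+ 2 <= beta * (\sum_i ((W n j.+1 (k + ev i) - W n j.+1 k) ^+ 2 +
       (W n j.+1 (k - ev i) - W n j.+1 k) ^+ 2)) &
  W n.+1 j k = stp (tau / h) N
    (f (tg tau j.+1) (pt h k) (policy tau h alpha alpha0 Vn n.+1 j.+1 k) 0)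
    (W n.+1 j.+1) k + tau * B.
Proof.
move=> jM; have tT := tgT jM; set t := tg tau j.+1 in tT *.
have aA := policyA n.+1 k jM; set a := policy _ _ _ _ _ _ _ _ in aA *.
have bA := optA k jM; set b := opt j.+1 k in bA.
pose g := gradh h (V j.+1) k.
(* Split of the drift terms as [grad W . f(a) + grad V . (f(a) - f(b))]: the first part belongs to
   [stp], the second is source and involves only the gradient of [V]. *)
exists (c t (pt h k) a - c t (pt h k) b + dotp g (f t (pt h k) a - f t (pt h k) b)); last first.
  rewrite /W stpB Vn_step // V_step //= -/t -/a -/b !stpE // -/g.
  have -> : dotp g (f t (pt h k) a - f t (pt h k) b) =
      dotp g (f t (pt h k) a) - dotp g (f t (pt h k) b).
    by rewrite /dotp -sumrB; apply: eq_bigr => i _; rewrite !mxE; ring.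
  ring.
set B := _ + _; set Q := \sum_i _.
have := cfL (pt h k) (pt h k) tT aA bA.
rewrite subrr (_ : enorm 0 = 0) ?add0r; last first.
  by rewrite /enorm big1 ?sqrtr0 // => i _; rewrite mxE expr0n.
move=> [cl fl].
have ab : enorm (a - b) <= K * enorm (gradh h (W n j.+1) k).
  by rewrite /W -gradhB /a /b /opt /=; exact: alphaL.
set x := enorm (gradh h (W n j.+1) k) in ab.
have x0 : 0 <= x := enorm_ge0 _.
have HB : `|B| <= (1 + G) * (K ^+ 2 * x).
  have abK : K * enorm (a - b) <= K ^+ 2 * x by rewrite expr2 -mulrA ler_pM2l.
  apply: le_trans (ler_normD _ _) _; rewrite mulrDl mul1r; apply: lerD.
    exact: le_trans cl abK.
  apply: le_trans (dotp_le _ _) _; apply: ler_pM; rewrite ?enorm_ge0 //.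
    exact: gradh_V_le_gradsup.
  exact: le_trans fl abK.
have hx : h ^+ 2 * x ^+ 2 <= Q / 2 by exact: enorm_gradh_sqr_le.
have HB2 : B ^+ 2 <= ((1 + G) * (K ^+ 2 * x)) ^+ 2.
  rewrite -[B ^+ 2]real_normK ?num_real // ler_sqr ?nnegrE //.
  exact: le_trans HB.
have G2 : (1 + G) ^+ 2 <= 2 * (1 + G ^+ 2) by have := sqr_ge0 (1 - G); nra.
apply: (@le_trans _ _ (h ^+ 2 * ((1 + G) * (K ^+ 2 * x)) ^+ 2)).
  by rewrite ler_wpM2l // sqr_ge0.
have -> : h ^+ 2 * ((1 + G) * (K ^+ 2 * x)) ^+ 2 =
    ((1 + G) ^+ 2 * K ^+ 4) * (h ^+ 2 * x ^+ 2) by ring.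
have -> : beta * Q = (2 * (1 + G ^+ 2) * K ^+ 4) * (Q / 2) by rewrite /beta; field.
have K40 : 0 <= K ^+ 4 by rewrite exprn_ge0 // ltW.
apply: ler_pM => //; last by rewrite ler_wpM2r.
- by rewrite mulr_ge0 ?sqr_ge0.
- by rewrite mulr_ge0 ?sqr_ge0.
Qed.

Hypothesis CFL2 : 64 * beta * tau <= h.

Let lam := 4 * d%:R * K ^+ 2 + 32 * beta + 6 * d%:R * N.
Let En r n j := wsum (weight h r) (fun k => W n j k ^+ 2).
Let Dn r n j := wsum (weight h r) (fun k => enorm (Dh h (W n j) k) ^+ 2).

Let beta_gt0 : 0 < beta.
Proof. by rewrite mulr_gt0 ?exprn_gt0 //; have := sqr_ge0 G; lra. Qed.

Let lam_ge0 : 0 <= lam.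
Proof.
have dK : 0 <= d%:R * K ^+ 2 by rewrite mulr_ge0 ?sqr_ge0.
have dN : 0 <= d%:R * N by rewrite mulr_ge0 // ltW.
have := ltW beta_gt0; rewrite /lam; lra.
Qed.

Lemma policy_iteration_energy r n j : (j <= M)%N ->
  (En r n.+1 j <= (h * tau / 2 ^+ n.+2)%:E *
     \sum_(j.+1 <= s < M.+1) ((1 + tau / h * lam) ^+ (s - j.+1)%N)%:E * Dn r 0%N s)%E.
Proof.
move=> jM; have w0 := @weight_ge0 R d h r.
have -> : h * tau / 2 ^+ n.+2 = (tau * h / 2) / 2 ^+ n.+1.
  by rewrite [2 ^+ n.+2]exprS invfM; ring.
apply: (energy_induction (E := En r) (D := Dn r)) => //.
- by rewrite addr_ge0 // mulr_ge0 // ltW.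
- by rewrite divr_ge0 // mulr_ge0 // ltW.
- by move=> *; apply: wsum_ge0 => // k; exact: sqr_ge0.
- by move=> *; apply: wsum_ge0 => // k; exact: sqr_ge0.
(* Both schemes start from the same terminal data. *)
- by move=> n'; rewrite /En /wsum esum1 // => k _; rewrite /W VT VnT subrr expr0n mulr0.
move=> {}n {}j {}jM.
have /choice[B HB] : forall k, exists B,
    h ^+ 2 * B ^+ 2 <= beta * (\sum_i ((W n j.+1 (k + ev i) - W n j.+1 k) ^+ 2 +
       (W n j.+1 (k - ev i) - W n j.+1 k) ^+ 2)) /\
    W n.+1 j k = stp (tau / h) N
      (f (tg tau j.+1) (pt h k) (policy tau h alpha alpha0 Vn n.+1 j.+1 k) 0)
      (W n.+1 j.+1) k + tau * B.
  by move=> k; have [B B1 B2] := policy_error n k jM; exists B.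
rewrite (_ : tau * h / 2 / 2 = tau * h / 4); last by field.
apply: (@energy_step _ _ _ w0 _ _ N K beta tau h _ _ _ B (fun k i =>
   f (tg tau j.+1) (pt h k) (policy tau h alpha alpha0 Vn n.+1 j.+1 k) 0 i)) => //.
- by move=> k i; exact: weightD.
- by move=> k i; exact: weightB.
- move=> k i; apply: le_trans (norm_le_enorm _ _) _.
  by case: (cfK (pt h k) (tgT jM) (policyA n.+1 k jM)).
- by move=> k i; apply: f2N; [exact: tgT | exact: policyA].
- by move=> k; case: (HB k).
- by move=> k; case: (HB k).
Qed.

Lemma policy_iteration_ball Lam r n j : lam <= Lam -> (j <= M)%N ->
  (\esum_(k in [set k : 'rV[int]_d | (enorm (pt h k) <= r)%R])
      ((Vn n.+1 j k - V j k) ^+ 2)%:E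
   <= (h * tau / 2 ^+ n.+2)%:E * \sum_(j <= s < M.+1)
      \esum_(k in [set: 'rV[int]_d])
        (expR (Lam * (tg tau s - tg tau j) / h)
         * enorm (Dh h (fun k' => Vn 0%N s k' - V s k') k) ^+ 2
         * Num.min 1 (expR (- enorm (pt h k) + r + 1)))%:E)%E.
Proof.
move=> lamL jM; have w0 := @weight_ge0 R d h r.
have lam0 := lam_ge0.
apply: le_trans (@ball_le_wsum R d h r (fun k => W n.+1 j k ^+ 2) _) _.
  by move=> k; exact: sqr_ge0.
apply: le_trans (policy_iteration_energy r n jM) _.
apply: lee_wpmul2l.
  by rewrite lee_fin divr_ge0 // mulr_ge0 // ltW.
(* The energy estimate sums from [j.+1]; the term [s = j] of the stated sum is nonnegative and is
   added for free. *)
rewrite [leRHS]big_ltn //; apply: le_trans (leeDr _ _); last first.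
  apply: esum_ge0 => k _; rewrite lee_fin; apply: mulr_ge0; last exact: w0.
  by rewrite mulr_ge0 ?expR_ge0 ?sqr_ge0.
rewrite !big_nat; apply: lee_sum => s /andP[js sM].
have e0 : 0 <= 1 + tau / h * lam by rewrite addr_ge0 // mulr_ge0 // ltW.
rewrite -wsumZ ?exprn_ge0 //; last by move=> k; exact: sqr_ge0.
apply: le_esum => k _; rewrite lee_fin mulrC.
apply: ler_wpM2r; first exact: w0.
apply: ler_wpM2r; first exact: sqr_ge0.
apply: (@le_trans _ _ (expR (tau / h * Lam) ^+ (s - j.+1)%N)).
  apply: lerXn2r; rewrite ?nnegrE ?expR_ge0 //.
  apply: le_trans (expR_ge1Dx _) _.
  by rewrite ler_expR ler_pM2l.
rewrite -expRM_natl ler_expR.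
have -> : Lam * (tg tau s - tg tau j) / h = (s - j)%N%:R * (tau / h * Lam).
  by rewrite /tg -mulrBl natrB ?(ltnW js) //; ring.
apply: ler_wpM2r; first by apply: mulr_ge0; [exact: ltW | exact: le_trans lamL].
by rewrite ler_nat leq_sub2l.
Qed.

(** Only the sup bounds are used: the error is at most [2 * K * (1 + T)], its difference quotients
    at most twice that over [h]. The resulting [h^-2] is harmless under the exponential. *)
Lemma initial_energy_le r s : (0 < d)%N -> 1 <= r -> (s <= M)%N ->
  (Dn r 0%N s <= ((d%:R * (4 * K * (1 + T) / h)) ^+ 2 *
     (expR 2 * (4 * d%:R * r / h) ^+ d))%:E)%E.
Proof.
move=> d0 r1 sM.
have T0 : 0 <= T by rewrite TM mulr_ge0 // ltW.
have z0 : 0 <= 4 * K * (1 + T) by rewrite !mulr_ge0 ?addr_ge0 ?(ltW K0).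
have Wb k : `|W 0%N s k| <= 2 * (K * (1 + T)).
  apply: le_trans (ler_normB _ _) _.
  have := V_bounded k sM; have := Vn_bounded 0 k sM.
  have : K * (1 + (T - tg tau s)) <= K * (1 + T).
    by rewrite ler_pM2l // lerD2l; have /andP[] := tgT sM; lra.
  lra.
have Db k : enorm (Dh h (W 0%N s) k) <= d%:R * (4 * K * (1 + T) / h).
  apply: enorm_Dh_le => // k' i.
  apply: le_trans (ler_normB _ _) _.
  by have := Wb (k' + ev i); have := Wb k'; lra.
set D := d%:R * _ in Db *.
have D0 : 0 <= D by apply: le_trans (Db 0); exact: enorm_ge0.
apply: (@le_trans _ _ (wsum (weight h r) (fun=> (D ^+ 2 * 1)%R))).
  apply: le_wsum => [k|k]; first exact: weight_ge0.
  by rewrite mulr1 ler_sqr ?nnegrE ?enorm_ge0.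
rewrite wsumZ ?sqr_ge0 //; last by move=> k; exact: weight_ge0.
rewrite [leRHS]EFinM; apply: lee_wpmul2l; first by rewrite lee_fin sqr_ge0.
apply: le_trans (esum_weight_le d0 h01 r1).
by apply: le_esum => k _; rewrite mulr1.
Qed.

(** The powers of [h] combine to [h * h^-2 * h^-d], and [tau] times the number of steps gives
    [T]. *)
Lemma energy_bound r n j : (0 < d)%N -> 1 <= r -> (j <= M)%N ->
  (En r n.+1 j <= (2 ^- n.+1 * (8 * d%:R ^+ 2 * K ^+ 2 * expR 2 * (4 * d%:R) ^+ d)
     * (T * (1 + T) ^+ 2 / h ^+ d.+1 * expR (lam * T / h)) * r ^+ d)%:E)%E.
Proof.
move=> d0 r1 jM; have lam0 := lam_ge0.
have r0 : 0 <= r by apply: le_trans r1.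
apply: le_trans (policy_iteration_energy r n jM) _.
set D := (d%:R * (4 * K * (1 + T) / h)) ^+ 2 * (expR 2 * (4 * d%:R * r / h) ^+ d).
have D0 : 0 <= D.
  rewrite mulr_ge0 ?sqr_ge0 // mulr_ge0 ?expR_ge0 // exprn_ge0 //.
  by rewrite divr_ge0 ?(ltW h0) // !mulr_ge0.
have T0 : 0 <= T by rewrite TM mulr_ge0 // ltW.
have e0 : 0 <= 1 + tau / h * lam by rewrite addr_ge0 // mulr_ge0 // ltW.
pose X := expR (lam * T / h) * D.
apply: (@le_trans _ _ ((h * tau / 2 ^+ n.+2)%:E * (M%:R * X)%:E)%E).
  apply: lee_wpmul2l; first by rewrite lee_fin divr_ge0 // mulr_ge0 // ltW.
  apply: (@le_trans _ _ (\sum_(j.+1 <= s < M.+1) X%:E)%E).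
    rewrite !big_nat; apply: lee_sum => s /andP[js sM].
    rewrite /X [leRHS]EFinM; apply: lee_pmul.
    - by rewrite lee_fin exprn_ge0.
    - by apply: wsum_ge0 => k; [exact: weight_ge0 | exact: sqr_ge0].
    - rewrite lee_fin.
      apply: (@le_trans _ _ (expR (tau / h * lam) ^+ (s - j.+1)%N)).
        by apply: lerXn2r; rewrite ?nnegrE ?expR_ge0 // expR_ge1Dx.
      rewrite -expRM_natl ler_expR.
      have -> : lam * T / h = M%:R * (tau / h * lam) by rewrite TM; ring.
      apply: ler_wpM2r; first by rewrite mulr_ge0 // ltW.
      rewrite ler_nat; by apply: leq_trans (leq_subr _ _) _.
    - exact: initial_energy_le.
  rewrite sumEFin lee_fin sumr_const_nat -[leLHS]mulr_natl.
  apply: ler_wpM2r; first by rewrite mulr_ge0 ?expR_ge0.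
  by rewrite ler_nat subSS leq_subr.
rewrite -EFinM lee_fin le_eqVlt; apply/orP; left; apply/eqP.
rewrite /X /D (_ : (4 * d%:R * r / h) ^+ d = (4 * d%:R) ^+ d * r ^+ d / h ^+ d); last first.
  by rewrite -exprVn -!exprMn.
rewrite [2 ^+ n.+2]exprS [h ^+ d.+1]exprS; move: (expR (lam * T / h)) (expR 2) => e1 e2.
have p0 : 2 ^+ n.+1 != 0 :> R by rewrite gt_eqF ?exprn_gt0.
have hd0 : h ^+ d != 0 by rewrite expf_neq0 // gt_eqF.
move: (2 ^+ n.+1) ((4 * d%:R) ^+ d) (r ^+ d) (h ^+ d) p0 hd0 => p a b hd p0 hd0.
by rewrite TM; field; rewrite hd0 p0 gt_eqF.
Qed.

(** The Lipschitz bound on [alpha] reduces policies to gradients, and gradients to neighbouring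
    values of the error at the price of [h^-2]. *)
Lemma policy_ball_le r n j : (j <= M)%N ->
  (\esum_(k in [set k : 'rV[int]_d | (enorm (pt h k) <= r)%R])
      (enorm (alpha (tg tau j) (pt h k) (gradh h (Vn n j) k)
            - alpha (tg tau j) (pt h k) (gradh h (V j) k)) ^+ 2)%:E
   <= (3 * d%:R * K ^+ 2 / h ^+ 2)%:E * En r n j)%E.
Proof.
move=> jM; have w0 := @weight_ge0 R d h r.
apply: le_trans (@ball_le_wsum R d h r (fun k => enorm (alpha (tg tau j) (pt h k) (gradh h (Vn n j) k)
            - alpha (tg tau j) (pt h k) (gradh h (V j) k)) ^+ 2) _) _.
  by move=> k; exact: sqr_ge0.
pose Q k := \sum_i (W n j (k + ev i) ^+ 2 + W n j (k - ev i) ^+ 2).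
have Q0 k : 0 <= Q k by apply: sumr_ge0 => i _; rewrite addr_ge0 ?sqr_ge0.
have c0 : 0 <= K ^+ 2 / (2 * h ^+ 2) by rewrite divr_ge0 ?sqr_ge0 // mulr_ge0 ?sqr_ge0.
apply: (@le_trans _ _ (wsum (weight h r) (fun k => (K ^+ 2 / (2 * h ^+ 2) * Q k)%R))).
  apply: le_wsum => // k.
  have H := alphaL (pt h k) (gradh h (Vn n j) k) (gradh h (V j) k) (tgT jM).
  apply: (@le_trans _ _ ((K * enorm (gradh h (W n j) k)) ^+ 2)).
    rewrite ler_sqr ?nnegrE ?enorm_ge0 ?mulr_ge0 ?enorm_ge0 ?(ltW K0) //.
    by rewrite /W -gradhB.
  rewrite exprMn -mulrA ler_pM2l ?exprn_gt0 // enorm_sqr /Q mulr_sumr.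
  apply: ler_sum => i _; rewrite mxE.
  have -> : ((W n j (k + ev i) - W n j (k - ev i)) / (2 * h)) ^+ 2 =
    (2 * h ^+ 2)^-1 * ((W n j (k + ev i) - W n j (k - ev i)) ^+ 2 / 2).
    by field; rewrite gt_eqF.
  apply: ler_wpM2l; first by rewrite invr_ge0 mulr_ge0 ?sqr_ge0.
  by have := sqr_ge0 (W n j (k + ev i) + W n j (k - ev i)); nra.
rewrite wsumZ //.
have -> : 3 * d%:R * K ^+ 2 / h ^+ 2 = K ^+ 2 / (2 * h ^+ 2) * (6 * d%:R).
  by field; rewrite gt_eqF.
rewrite [(_ * (6 * _))%:E]EFinM -muleA; apply: lee_wpmul2l; first by rewrite lee_fin.
by apply: wsum_neighbours => // k i; [exact: weightD | exact: weightB].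
Qed.

End Scheme.

(** * Absorption of the prefactors and choice of the universal constant *)

Lemma exponential_absorbs (R : realType) (C T h G a b : R) (p : nat) :
  1 <= T -> 0 < h < 1 -> 0 <= G -> 0 <= a -> 0 <= b -> G <= b * expR (b * T) ->
  3 + p%:R + a * (1 + b ^+ 2) <= C -> 2 * b + 1 <= C ->
  T * (1 + T) ^+ 2 / h ^+ p * expR (a * (1 + G ^+ 2) * T / h) <=
  expR (C * expR (C * T) / h).
Proof.
move=> T1 /andP[h0 h1] G0 a0 b0 Gb C1 C2.
have T0 : 0 <= T by lra.
have TeT : 1 + T <= expR T := expR_ge1Dx T.
have e1 : 1 <= expR (C * T).
  by rewrite -[leLHS]expR0 ler_expR mulr_ge0 //; lra.
have TeC : expR T <= expR (C * T).
  by rewrite ler_expR ler_peMl //; lra.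
have B1 : T * (1 + T) ^+ 2 <= expR (3 * T).
  rewrite [expR (3 * T)]expRM_natl exprS; apply: ler_pM; rewrite ?sqr_ge0 //; first lra.
  by rewrite ler_sqr ?nnegrE ?expR_ge0 //; lra.
have B2 : (h ^+ p)^-1 <= expR (p%:R / h).
  rewrite -exprVn expRM_natl lerXn2r ?nnegrE ?expR_ge0 ?invr_ge0 ?(ltW h0) //.
  by apply: le_trans (expR_ge1Dx _); rewrite lerDr.
apply: (@le_trans _ _ (expR (3 * T) * expR (p%:R / h) *
    expR (a * (1 + G ^+ 2) * T / h))).
  rewrite ler_wpM2r ?expR_ge0 //; apply: ler_pM => //.
    by rewrite mulr_ge0 ?sqr_ge0.
  by rewrite invr_ge0 exprn_ge0 // ltW.
rewrite -!expRD ler_expR ler_pdivlMr // mulrDl divfK ?gt_eqF // mulrDl divfK ?gt_eqF //.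
set X := expR (C * T) in e1 TeC *.
(* Here [G^2 <= b^2 * e^(2 b T)] and [T <= e^T], so the rate [2 * b + 1] must not exceed [C]. *)
have G2 : (1 + G ^+ 2) * T <= (1 + b ^+ 2) * X.
  have E2 : 1 <= expR (b * T) by rewrite -[leLHS]expR0 ler_expR mulr_ge0.
  apply: (@le_trans _ _ (((1 + b ^+ 2) * expR (b * T) ^+ 2) * expR T)).
    apply: ler_pM => //; [by rewrite addr_ge0 ?sqr_ge0 | | lra].
    rewrite mulrDl mul1r -exprMn; apply: lerD; first by rewrite expr_ge1.
    by rewrite ler_sqr ?nnegrE // mulr_ge0 ?expR_ge0.
  rewrite -mulrA; apply: ler_wpM2l; first by rewrite addr_ge0 ?sqr_ge0.
  rewrite -expRM_natl -expRD ler_expR.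
  have -> : 2 * (b * T) + T = (2 * b + 1) * T by ring.
  by rewrite ler_wpM2r.
have aG2 := ler_wpM2l a0 G2.
have Th : 3 * T * h <= 3 * X.
  have : T * h <= T by rewrite ler_piMr // ltW.
  lra.
have pX : p%:R <= p%:R * X by rewrite ler_peMr.
have CX : (3 + p%:R + a * (1 + b ^+ 2)) * X <= C * X.
  by rewrite ler_wpM2r //; lra.
lra.
Qed.

Theorem theorem4p1 (R : realType) (d : nat) (N L : R) :
  (0 < d)%N -> 1 <= N ->
  exists C : R, 0 < C /\
  forall (m : nat) (T : R) (A : set 'rV[R]_m)
    (c : R -> 'rV[R]_d -> 'rV[R]_m -> R)
    (f : R -> 'rV[R]_d -> 'rV[R]_m -> 'rV[R]_d)
    (q : 'rV[R]_d -> R)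
    (alpha : R -> 'rV[R]_d -> 'rV[R]_d -> 'rV[R]_m)
    (alpha0 : R -> 'rV[R]_d -> 'rV[R]_m)
    (tau h : R) (M : nat)
    (V : nat -> 'rV[int]_d -> R)
    (Vn : nat -> nat -> 'rV[int]_d -> R),
  (* setting *)
  1 <= T -> compact A ->
  (* (A1): boundedness and Lipschitz continuity, constants <= L *)
  (forall t x a, 0 <= t <= T -> a \in A ->
     `|c t x a| <= L /\ enorm (f t x a) <= L) ->
  (forall x, `|q x| <= L) ->
  (forall t t' x x' a a', 0 <= t <= T -> 0 <= t' <= T -> a \in A -> a' \in A ->
     `|c t x a - c t' x' a'| <= L * (`|t - t'| + enorm (x - x') + enorm (a - a')) /\
     enorm (f t x a - f t' x' a') <= L * (`|t - t'| + enorm (x - x') + enorm (a - a'))) ->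
  (forall x x', `|q x - q x'| <= L * enorm (x - x')) ->
  (* alpha(t,x,p) is the unique minimizer over A; alpha0 is a policy with values in A *)
  (forall t x p, 0 <= t <= T ->
     alpha t x p \in A /\
     forall a, a \in A -> a <> alpha t x p ->
       c t x (alpha t x p) + dotp p (f t x (alpha t x p)) < c t x a + dotp p (f t x a)) ->
  (forall t x, 0 <= t <= T -> alpha0 t x \in A) ->
  (* (A2): Lipschitz continuity of alpha and alpha0, constants <= L *)
  (forall t t' x x' p p', 0 <= t <= T -> 0 <= t' <= T ->
     enorm (alpha t x p - alpha t' x' p') <= L * (`|t - t'| + enorm (x - x') + enorm (p - p'))) ->
  (forall t t' x x', 0 <= t <= T -> 0 <= t' <= T ->
     enorm (alpha0 t x - alpha0 t' x') <= L * (`|t - t'| + enorm (x - x'))) ->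
  (* discretisation parameters *)
  0 < tau < 1 -> 0 < h < 1 -> (0 < M)%N -> T = M%:R * tau ->
  (forall t x a, 0 <= t <= T -> a \in A -> enorm (f t x a) / 2 <= N) ->
  N <= h / (2 * tau) ->
  (* V solves the discrete HJB equation *)
  (forall j k, (1 <= j <= M)%N ->
     (V j k - V j.-1 k) / tau + Ham A c f (tg tau j) (pt h k) (gradh h (V j) k)
       = - (N * h) * laplh h (V j) k) ->
  (forall k, V M k = q (pt h k)) ->
  (* V_n solve the discrete policy iteration *)
  (forall n j k, (1 <= j <= M)%N ->
     (Vn n j k - Vn n j.-1 k) / tau
       + c (tg tau j) (pt h k) (policy tau h alpha alpha0 Vn n j k)
       + dotp (gradh h (Vn n j) k) (f (tg tau j) (pt h k) (policy tau h alpha alpha0 Vn n j k))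
       = - (N * h) * laplh h (Vn n j) k) ->
  (forall n k, Vn n M k = q (pt h k)) ->
  (* conclusion *)
  let G := gradsup M h V in
  C * (1 + G ^+ 2) * tau <= h ->
  (forall (n : nat) (Rr : R) (j : nat), (1 <= n)%N -> 1 <= Rr -> (j <= M)%N ->
     (\esum_(k in [set k : 'rV[int]_d | (enorm (pt h k) <= Rr)%R]) ((Vn n j k - V j k) ^+ 2)%:E
      <= ((h * tau) / 2 ^+ n.+1)%:E *
         \sum_(j <= s < M.+1)
           \esum_(k in [set: 'rV[int]_d])
             (expR (C * expR (1 + G ^+ 2) * (tg tau s - tg tau j) / h)
              * enorm (Dh h (fun k' => Vn 0%N s k' - V s k') k) ^+ 2
              * Num.min 1 (expR (- enorm (pt h k) + Rr + 1)))%:E)%E) /\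
  (forall (n : nat) (Rr : R) (j : nat), (1 <= n)%N -> 1 <= Rr -> (j <= M)%N ->
     (\esum_(k in [set k : 'rV[int]_d | (enorm (pt h k) <= Rr)%R]) ((Vn n j k - V j k) ^+ 2)%:E
      <= (C * 2 ^- n * expR (C * expR (C * T) / h) * Rr ^+ d)%:E)%E) /\
  (forall (n : nat) (Rr : R) (j : nat), (1 <= n)%N -> 1 <= Rr -> (j <= M)%N ->
     (\esum_(k in [set k : 'rV[int]_d | (enorm (pt h k) <= Rr)%R])
        (enorm (alpha (tg tau j) (pt h k) (gradh h (Vn n j) k)
                - alpha (tg tau j) (pt h k) (gradh h (V j) k)) ^+ 2)%:E
      <= (C * 2 ^- n * expR (C * expR (C * T) / h) * Rr ^+ d)%:E)%E).
Proof.
(* [L] carries no sign condition, while the estimates use a constant that is at least 1. *)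
move=> d0 N1; pose K := 1 + `|L|.
have LK : L <= K by rewrite /K; have := ler_norm L; lra.
have K1 : 1 <= K by rewrite /K lerDl.
pose P := 8 * d%:R ^+ 2 * K ^+ 2 * expR 2 * (4 * d%:R) ^+ d.
pose P' := 3 * d%:R * K ^+ 2 * P.
pose a := 4 * d%:R * K ^+ 2 + 32 * K ^+ 4 + 6 * d%:R * N.
pose b := d%:R * K + 1.
(* All summands are nonnegative, so [C] dominates each: the prefactors [P] and [P'] of the two final
   bounds, the exponent requirements ([6 + d] is [3 + p] for the largest power [p = d + 3]), and
   both step-size conditions. *)
pose C := 1 + P + P' + (6 + d%:R) + a * (1 + b ^+ 2) + (2 * b + 1)
  + 128 * d%:R * N ^+ 2 + 64 * K ^+ 4.
have K0 : 0 <= K by lra.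
have P0 : 0 <= P.
  by rewrite !mulr_ge0 ?exprn_ge0 ?expR_ge0 // mulr_ge0.
have P'0 : 0 <= P' by rewrite !mulr_ge0 ?exprn_ge0.
have K40 : 0 <= K ^+ 4 by rewrite exprn_ge0.
have dK0 : 0 <= d%:R * K by rewrite mulr_ge0.
have dK20 : 0 <= d%:R * K ^+ 2 by rewrite mulr_ge0 ?sqr_ge0.
have dN0 : 0 <= d%:R * N by rewrite mulr_ge0 //; lra.
have dN20 : 0 <= d%:R * N ^+ 2 by rewrite mulr_ge0 ?sqr_ge0.
have a0 : 0 <= a by rewrite /a; lra.
have b0 : 0 <= b by rewrite /b; lra.
have ab0 : 0 <= a * b ^+ 2 by rewrite mulr_ge0 ?sqr_ge0.
have dr0 : 0 <= d%:R :> R by [].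
have C0 : 0 < C by rewrite /C; lra.
have PC : P <= C by rewrite /C; lra.
have P'C : P' <= C by rewrite /C; lra.
have aC : a <= C by rewrite /C; lra.
have CbC : 2 * b + 1 <= C by rewrite /C; lra.
have CdC : 6 + d%:R + a * (1 + b ^+ 2) <= C by rewrite /C; lra.
have CFLC : 128 * d%:R * N ^+ 2 <= C by rewrite /C; lra.
have CFL2C : 64 * K ^+ 4 <= C by rewrite /C; lra.
exists C; split=> //.
move=> m T A c f q alpha alpha0 tau h M V Vn T1 _ cfK qK cfL qL amin a0A aL _
  /andP[t0 t1] h01 M0 TM fN _ HJB VT PI VnT G CFLG.
have h0 : 0 < h by case/andP: h01.
have T0 : 0 <= T := le_trans ler01 T1.
have en0 (y y' : R) : 0 <= y' -> L * (`|y - y| + y') <= K * y'.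
  by move=> y0; rewrite subrr normr0 add0r ler_wpM2r.
have cfK' t x a' : 0 <= t <= T -> a' \in A ->
    `|c t x a'| <= K /\ enorm (f t x a') <= K.
  by move=> tT aA; case: (cfK t x a' tT aA) => H1 H2; split; apply: le_trans LK.
have qK' x : `|q x| <= K by exact: le_trans LK.
have cfL' t x x' a1 a2 : 0 <= t <= T -> a1 \in A -> a2 \in A ->
  `|c t x a1 - c t x' a2| <= K * (enorm (x - x') + enorm (a1 - a2)) /\
  enorm (f t x a1 - f t x' a2) <= K * (enorm (x - x') + enorm (a1 - a2)).
  move=> tT a1A a2A; case: (cfL t t x x' a1 a2 tT tT a1A a2A) => H1 H2.
  have e0 : 0 <= enorm (x - x') + enorm (a1 - a2) by rewrite addr_ge0 ?enorm_ge0.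
  by split; [apply: le_trans H1 _ | apply: le_trans H2 _]; rewrite -addrA; exact: en0.
have qL' x x' : `|q x - q x'| <= K * enorm (x - x').
  by apply: le_trans (qL x x') _; rewrite ler_wpM2r ?enorm_ge0.
have aL' t x p p' : 0 <= t <= T ->
    enorm (alpha t x p - alpha t x p') <= K * enorm (p - p').
  move=> tT; apply: le_trans (aL t t x x p p' tT tT) _.
  rewrite (_ : enorm (x - x) = 0) ?addr0; first by apply: en0; exact: enorm_ge0.
  by rewrite subrr /enorm big1 ?sqrtr0 // => i _; rewrite mxE expr0n.
have G1 : 1 <= 1 + G ^+ 2 by rewrite lerDl sqr_ge0.
(* Both step-size conditions are read off from [C * (1 + G^2) * tau <= h]. *)
have CFL : 128 * d%:R * N ^+ 2 * tau <= h.
  apply: le_trans CFLG; rewrite ler_pM2r //.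
  by apply: le_trans CFLC _; rewrite ler_peMr // ltW.
have CFL2 : 64 * (K ^+ 4 * (1 + G ^+ 2)) * tau <= h.
  apply: le_trans CFLG; rewrite ler_pM2r // mulrA ler_wpM2r //.
  by apply: le_trans G1.
have Gb : G <= b * expR (b * T).
  apply: le_trans (gradsup_le K1 N1 t0 h01 TM cfL' qL' amin fN HJB VT CFL) _.
  by rewrite -/b ler_wpM2r ?expR_ge0 // /b lerDl.
have G0 : 0 <= G.
  exact: (gradsup_ge0 K1 N1 t0 h01 TM cfL' qL' amin fN HJB VT CFL).
set lam := 4 * d%:R * K ^+ 2 + 32 * (K ^+ 4 * (1 + G ^+ 2)) + 6 * d%:R * N.
have lamG : lam <= a * (1 + G ^+ 2).
  rewrite /lam /a; have := sqr_ge0 G; set g := G ^+ 2 => g0.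
  have := mulr_ge0 dK20 g0; have := mulr_ge0 dN0 g0; lra.
have absorb p : (p <= d + 3)%N ->
    T * (1 + T) ^+ 2 / h ^+ p * expR (lam * T / h) <= expR (C * expR (C * T) / h).
  move=> pd; have pd' : p%:R <= d%:R + 3 :> R by rewrite -natrD ler_nat.
  have C1 : 3 + p%:R + a * (1 + b ^+ 2) <= C by move: pd' CdC; clear; lra.
  apply: le_trans (exponential_absorbs T1 h01 G0 a0 b0 Gb C1 CbC).
  apply: ler_wpM2l.
    by rewrite mulr_ge0 ?invr_ge0 ?exprn_ge0 ?(ltW h0) // mulr_ge0 ?sqr_ge0.
  by rewrite ler_expR ler_pM2r ?invr_gt0 // ler_wpM2r.
have energy n r j := @energy_bound _ _ _ _ _ _ _ _ _ _ _ _ _ _ _ _ _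
  K1 N1 t0 h01 TM cfK' qK' cfL' qL' amin a0A aL' fN HJB VT PI VnT CFL CFL2 r n j d0.
split; [|split] => -[//|n] r j _ r1 jM.
- apply: (policy_iteration_ball K1 N1 t0 h01 TM cfK' cfL' qL' amin a0A aL' fN
    HJB VT PI VnT CFL CFL2) => //.
  (* The growth rate is linear in [1 + G^2]; the exponential of the statement enters through
     [x <= e^x]. *)
  apply: le_trans lamG _; apply: ler_pM => //; first exact: le_trans ler01 G1.
  by apply: le_trans (expR_ge1Dx _); rewrite lerDr.
- have r0 : 0 <= r ^+ d := exprn_ge0 d (le_trans ler01 r1).
  apply: le_trans (@ball_le_wsum R d h r (fun k => (Vn n.+1 j k - V j k) ^+ 2) _) _.
    by move=> k; exact: sqr_ge0.
  apply: le_trans (energy n r j r1 jM) _.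
  rewrite lee_fin -/P -/lam ler_wpM2r //.
  rewrite (mulrC C); apply: ler_pM.
  + by rewrite mulr_ge0 // invr_ge0 exprn_ge0.
  + rewrite mulr_ge0 ?expR_ge0 // mulr_ge0 ?invr_ge0 ?exprn_ge0 ?(ltW h0) //.
    by rewrite mulr_ge0 ?sqr_ge0.
  + by rewrite ler_wpM2l ?invr_ge0 ?exprn_ge0.
  (* Here the power of [1 / h] is [d + 1]; for the policies it is [d + 3]. *)
  + by apply: absorb; rewrite -addn1 leq_add2l.
- have r0 : 0 <= r ^+ d := exprn_ge0 d (le_trans ler01 r1).
  apply: le_trans (policy_ball_le V Vn K1 t0 h01 TM aL' r n.+1 jM) _.
  have c0 : 0 <= 3 * d%:R * K ^+ 2 / h ^+ 2.
    by rewrite divr_ge0 ?sqr_ge0 // -mulrA mulr_ge0.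
  apply: (@le_trans _ _ ((3 * d%:R * K ^+ 2 / h ^+ 2)%:E * _)%E).
    by apply: lee_wpmul2l; [rewrite lee_fin | exact: energy].
  rewrite -EFinM lee_fin -/P -/lam.
  rewrite [leLHS](_ : _ = 2 ^- n.+1 * P' *
    (T * (1 + T) ^+ 2 / h ^+ (d + 3) * expR (lam * T / h)) * r ^+ d); last first.
    have hd : h ^+ d != 0 by rewrite expf_neq0 // gt_eqF.
    have p0 : 2 ^+ n.+1 != 0 :> R by rewrite gt_eqF ?exprn_gt0.
    rewrite /P' exprD [h ^+ d.+1]exprS.
    move: (2 ^+ n.+1) (h ^+ d) (r ^+ d) (expR _) P hd p0 {P0 P'0 PC P'C absorb energy c0 r0 C C0 aC CbC CdC CFLC CFL2C CFLG P'} => x y z e P y0 x0.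
    by field; rewrite x0 y0 gt_eqF.
  rewrite ler_wpM2r // (mulrC C); apply: ler_pM.
  + by rewrite mulr_ge0 // invr_ge0 exprn_ge0.
  + rewrite mulr_ge0 ?expR_ge0 // mulr_ge0 ?invr_ge0 ?exprn_ge0 ?(ltW h0) //.
    by rewrite mulr_ge0 ?sqr_ge0.
  + by rewrite ler_wpM2l ?invr_ge0 ?exprn_ge0.
  + exact: absorb.
Qed.
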